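(* Let $d,q$ be integers with $1\le q<d$, $\gcd(d,q)=1$, and $X=X(d;1,q)$. If $k\in\mathbb Z$ and $[k]=[k_0,k_1,\dots,k_n,k_{n+1}]$ is the greedy $X$-decomposition of $k$, then $$\mathcal O_X(k)=\bigotimes_{i=1}^n\mathcal O_X(q_i)^{k_i},$$ where the right-hand side denotes the product of eigenmodules inside $\mathcal O_{\mathbb C^2,0}$, i.e. the $\mathcal O_X$-submodule of $\mathcal O_{\mathbb C^2,0}$ generated by all products of $k_1$ elements of $\mathcal O_X(q_1)$, $k_2$ elements of $\mathcal O_X(q_2)$, ..., $k_n$ elements of $\mathcal O_X(q_n)$ (the empty product being $\mathcal O_X$).
   Context: $G_d\subset\mathbb C^*$ is the group of $d$-th roots of unity and $X=X(d;1,q)=\mathbb C^2/G_d$ for the action $\xi\cdot(x,y)=(\xi x,\xi^q y)$. For $k\in\mathbb Z$, $\mathcal O_X(k)=\{f\in\mathcal O_{\mathbb C^2,0}\mid f(\xi x,\xi^q y)=\xi^k f(x,y)\ \forall\xi\in G_d\}$, where $\mathcal O_{\mathbb C^2,0}$ is the ring of germs of holomorphic functions at the origin; $\mathcal O_X=\mathcal O_X(0)$, and $\mathcal O_X(k)$ is an $\mathcal O_X$-module depending only on $k\bmod d$. Numerical data: $q_0=d$, $q_1=q$, $q_{i-1}=c_iq_i-q_{i+1}$ with $c_i=\lceil q_{i-1}/q_i\rceil\ge2$, $q_0>q_1>\dots>q_n=1>q_{n+1}=0$. Greedy $X$-decomposition: for $k\in\mathbb Z$ let $0\le k'<d$ with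 $k'\equiv k\bmod d$. Then $[k]=[k_0,k_1,\dots,k_n,k_{n+1}]$ has $k_0=k_{n+1}=0$ and $k_1,\dots,k_n$ given by successive Euclidean divisions $k'=k_1q_1+k_1'$, $k_i'=k_{i+1}q_{i+1}+k_{i+1}'$ for $i\ge1$; thus $k'=\sum_{i=1}^nk_iq_i$. *)

(* Defs.v *)
From Stdlib Require Import Reals ZArith Lia.
From Coquelicot Require Import Coquelicot.
Local Open Scope Z_scope.

(** An element of O_{C^2,0} is given by a representative, a total function
    [C * C -> C] holomorphic near the origin; two representatives give the same
    germ when they are related by [germ_eq]. A subset of O_{C^2,0} is a
    predicate on representatives invariant under [germ_eq]. *)

Definition C2 : NormedModule C_AbsRing :=
  prod_NormedModule C_AbsRing C_NormedModule C_NormedModule.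

Definition origin : C2 := (RtoC 0, RtoC 0).

Definition germ_eq (f g : C * C -> C) : Prop :=
  locally origin (fun z : C2 => f z = g z).

(** [ex_filterdiff] over the scalars [C_AbsRing] asks for a C-linear
    differential, so this is complex differentiability near the origin. *)
Definition holomorphic_germ (f : C * C -> C) : Prop :=
  locally origin (fun z : C2 =>
    @ex_filterdiff C_AbsRing C2 C_NormedModule f (locally z)).

Definition Cpowz (z : C) (m : Z) : C :=
  match m with
  | Z0 => RtoC 1
  | Zpos p => Cpow z (Pos.to_nat p)
  | Zneg p => Cinv (Cpow z (Pos.to_nat p))
  end.

Definition root_of_unity (d : Z) (xi : C) : Prop := Cpowz xi d = RtoC 1.

(** O_X(k) for X = X(d;1,q). *)
Definition OX (d q k : Z) (f : C * C -> C) : Prop :=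
  holomorphic_germ f /\
  forall xi : C, root_of_unity d xi ->
    germ_eq (fun z => f (Cmult xi (fst z), Cmult (Cpowz xi q) (snd z)))
            (fun z => Cmult (Cpowz xi k) (f z)).

(** The O_X-submodule generated by [S], where O_X is [OX d q 0]. *)
Inductive OX_span (d q : Z) (S : (C * C -> C) -> Prop) : (C * C -> C) -> Prop :=
  | span_gen f : S f -> OX_span d q S f
  | span_zero : OX_span d q S (fun _ => RtoC 0)
  | span_add f g : OX_span d q S f -> OX_span d q S g ->
      OX_span d q S (fun z => Cplus (f z) (g z))
  | span_scale a f : OX d q 0 a -> OX_span d q S f ->
      OX_span d q S (fun z => Cmult (a z) (f z))
  | span_germ f g : germ_eq f g -> OX_span d q S f -> OX_span d q S g.

Fixpoint products_of (M : (C * C -> C) -> Prop) (m : nat) (f : C * C -> C) : Prop :=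
  match m with
  | O => germ_eq f (fun _ => RtoC 1)
  | S m' => exists g h, M g /\ products_of M m' h /\
              germ_eq f (fun z => Cmult (g z) (h z))
  end.

(** [qs 0] and [ks 0] are not used: the factors are indexed by 1, ..., n. *)
Fixpoint mixed_products (d q : Z) (qs ks : nat -> Z) (n : nat)
    (f : C * C -> C) : Prop :=
  match n with
  | O => germ_eq f (fun _ => RtoC 1)
  | S m => exists g h,
      mixed_products d q qs ks m g /\
      products_of (OX d q (qs (S m))) (Z.to_nat (ks (S m))) h /\
      germ_eq f (fun z => Cmult (g z) (h z))
  end.

Definition eigenmodule_product (d q : Z) (qs ks : nat -> Z) (n : nat) :
    (C * C -> C) -> Prop :=
  OX_span d q (mixed_products d q qs ks n).

(** Ceiling of [a / b], as [Z.div] rounds down for [b > 0]. *)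
Definition ceil_div (a b : Z) : Z := - ((- a) / b).

(** [qs 0 > ... > qs n = 1 > qs (n+1) = 0] is the sequence of Hirzebruch-Jung
    division of [d] by [q], with [c_(i+1) = ceil_div (qs i) (qs (i+1))]. *)
Record numerical_data (d q : Z) (n : nat) (qs : nat -> Z) : Prop := {
  nd_0 : qs 0%nat = d;
  nd_1 : qs 1%nat = q;
  nd_step : forall i, (i < n)%nat ->
    qs i = ceil_div (qs i) (qs (S i)) * qs (S i) - qs (S (S i));
  nd_decr : forall i, (i <= n)%nat -> qs (S i) < qs i;
  nd_n : qs n = 1;
  nd_end : qs (S n) = 0
}.

Lemma numerical_data_exists (d q : Z) :
  1 <= q < d -> Z.gcd d q = 1 -> exists n qs, numerical_data d q n qs.
Proof.
intros Hq; assert (Hq0 : 0 <= q) by lia; revert d Hq.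
pattern q; apply Z_lt_induction; [clear q Hq0; intros q IH d Hq Hg | exact Hq0].
set (r := (- d) mod q).
assert (Hr : 0 <= r < q) by (apply Z.mod_pos_bound; lia).
assert (Er : d = ceil_div d q * q - r).
{ unfold ceil_div, r; pose proof (Z.div_mod (- d) q ltac:(lia)); nia. }
destruct (Z.eq_dec q 1) as [->|Hq1].
- exists 1%nat, (fun i => match i with O => d | 1%nat => 1 | _ => 0 end).
  constructor; try reflexivity.
  + intros i Hi; replace i with 0%nat by lia; cbv beta iota; lia.
  + intros i Hi; destruct i as [|[|i]]; lia.
- assert (Hgr : Z.gcd q r = 1).
  { unfold r; rewrite Z.gcd_comm, Z.gcd_mod by lia.
    now rewrite Z.gcd_opp_r, Z.gcd_comm. }
  assert (r <> 0).
  { intros E; rewrite E, Z.gcd_0_r in Hgr; lia. }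
  destruct (IH r ltac:(lia) q ltac:(lia) Hgr) as (n & qs & [H0 H1 Hs Hd Hn He]).
  exists (S n), (fun i => match i with O => d | S j => qs j end).
  constructor; auto.
  + intros [|i] Hi; [now rewrite H0, H1 | apply Hs; lia].
  + intros [|i] Hi; [rewrite H0; lia | apply Hd; lia].
Qed.

(** [greedy_rem d qs k i] is the remainder [k_i'], starting from [k'].
    The digits [greedy d n qs k i] below are the [k_i], with [k_i = 0] outside 1, ..., n. *)
Fixpoint greedy_rem (d : Z) (qs : nat -> Z) (k : Z) (i : nat) : Z :=
  match i with
  | O => k mod d
  | S j => greedy_rem d qs k j mod qs (S j)
  end.

Definition greedy (d : Z) (n : nat) (qs : nat -> Z) (k : Z) (i : nat) : Z :=
  match i with
  | O => 0
  | S j => if Nat.leb (S j) n then greedy_rem d qs k j / qs (S j) else 0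
  end.

(* Main.v *)
(** A germ [f] in [O_X(k)] is a finite sum of terms [x^a y^b g] with [g] in [O_X]
    and [a + q b = k mod d]. To see this, expand the Cauchy kernel [z / (z - x)]
    as the sum over [a < d] of [x^a z^(d-a) / (z^d - x^d)]: Cauchy's formula then
    writes [f] as a sum of [x^a h_a(x^d, y)] with [h_a] holomorphic, and the same
    in [y] gives a sum of [x^a y^b h_ab(x^d, y^d)], where the last factor is
    invariant. Averaging over the powers of [exp(2 pi i / d)] deletes the monomials
    of the wrong weight. Since holomorphy is only pointwise complex
    differentiability, Cauchy's formula itself rests on Goursat's bisection argument.

    It remains to factor a monomial [x^a y^b] of weight [k]. Let [p_0 = 0], [p_1 = 1],
    [p_(i+1) = c_i p_i - p_(i-1)], so that [x^(q_i)] and [y^(p_i)] lie in [O_X(q_i)].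
    The vectors [(q_(i-1), p_(i-1))] and [(q_i, p_i)] form a basis of the lattice of
    pairs [(r, b)] with [r = q b mod d], and this forces [a >= q_i] or [b >= p_i] as soon as
    the weight has a residue in [[q_i, q_(i-1))]. Hence one can split off the factors
    [x^(q_i)] or [y^(p_i)] in the greedy order. *)

Require Import Defs.
From Stdlib Require Import Reals ZArith Lia Lra Psatz.
From Coquelicot Require Import Coquelicot.
Local Open Scope R_scope.

(** * Complex differentiability in two variables *)

(** Submodules admit only finite sums, so a Taylor expansion cannot be fed into the span term by
    term. Splitting exponents by residues modulo [d] leaves [d^2] terms and hides all convergence
    inside the invariant coefficients. Holomorphy as given provides no continuity of partial
    derivatives. Goursat's argument is therefore run on the image of the unit square under a
    differentiable map, which covers the homotopy from a large circle to a small one directly. The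
    coefficients of the splitting are Cauchy integrals in one variable, and their differentiability
    in both variables comes from second-order estimates that are uniform in the integration
    variable. In the lattice step, the vectors [(q_i, p_i)] start from [(d, 0)] and [(q, 1)], and
    both coordinates obey the same recurrence. The determinant of two neighbours thus keeps its
    initial value [d], up to sign, which is the index of the lattice: hence they form a basis. The
    inclusion of the product in [O_X(k)] is additivity of weights. *)

Definition cdiff2 (f : C * C -> C) (p : C * C) : Prop :=
  exists A B : C, forall eps : R, 0 < eps -> exists dl : R, 0 < dl /\
    forall x y : C, Cmod (x - fst p) < dl -> Cmod (y - snd p) < dl ->
    Cmod (f (x, y) - f p - A * (x - fst p) - B * (y - snd p))
      <= eps * (Cmod (x - fst p) + Cmod (y - snd p)).

Lemma Cmod_triangle_minus (x y : C) : Cmod (x - y) <= Cmod x + Cmod y.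
Proof. unfold Cminus; rewrite <- (Cmod_opp y); apply Cmod_triangle. Qed.

Lemma Cmod_minus_sym (x y : C) : Cmod (x - y) = Cmod (y - x).
Proof. rewrite <- Cmod_opp; f_equal; ring. Qed.

Lemma Cmod_le_minus (x y : C) : Cmod x <= Cmod y + Cmod (x - y).
Proof. replace x with (y + (x - y))%C at 1 by ring; apply Cmod_triangle. Qed.

Lemma cdiff2_lipschitz (f : C * C -> C) (p : C * C) : cdiff2 f p ->
  exists K dl : R, 0 < K /\ 0 < dl /\ forall x y : C,
    Cmod (x - fst p) < dl -> Cmod (y - snd p) < dl ->
    Cmod (f (x, y) - f p) <= K * (Cmod (x - fst p) + Cmod (y - snd p)).
Proof.
intros (A & B & H); destruct (H 1 Rlt_0_1) as (dl & Hdl & Hf).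
pose proof (Cmod_ge_0 A); pose proof (Cmod_ge_0 B).
exists (Cmod A + Cmod B + 1), dl; split; [lra|split; [assumption|]].
intros x y Hx Hy; specialize (Hf x y Hx Hy).
set (dx := (x - fst p)%C) in *; set (dy := (y - snd p)%C) in *.
replace (f (x, y) - f p)%C
  with ((f (x, y) - f p - A * dx - B * dy) + (A * dx + B * dy))%C by ring.
eapply Rle_trans; [apply Cmod_triangle|].
pose proof (Cmod_triangle (A * dx) (B * dy)) as T; rewrite !Cmod_mult in T.
pose proof (Cmod_ge_0 dx); pose proof (Cmod_ge_0 dy); nra.
Qed.

Lemma cdiff2_comp (f u v : C * C -> C) (p : C * C) :
  cdiff2 f (u p, v p) -> cdiff2 u p -> cdiff2 v p ->
  cdiff2 (fun z => f (u z, v z)) p.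
Proof.
intros (A & B & Hf) Hu Hv.
destruct (cdiff2_lipschitz u p Hu) as (K1 & d1 & HK1 & Hd1 & Lu).
destruct (cdiff2_lipschitz v p Hv) as (K2 & d2 & HK2 & Hd2 & Lv).
destruct Hu as (a1 & b1 & Hu); destruct Hv as (a2 & b2 & Hv).
exists (A * a1 + B * a2)%C, (A * b1 + B * b2)%C; intros eps Heps.
pose proof (Cmod_ge_0 A) as HA; pose proof (Cmod_ge_0 B) as HB.
(* Half of [eps] pays for the remainder of [f], whose arguments move by at most [(K1 + K2) * N] in
   total; the other half pays for the remainders of [u] and [v], weighted by the moduli of [A] and
   [B]. *)
set (e1 := eps / (2 * (K1 + K2))).
set (e2 := eps / (2 * (Cmod A + Cmod B + 1))).
assert (He1 : 0 < e1) by (apply Rdiv_lt_0_compat; lra).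
assert (He2 : 0 < e2) by (apply Rdiv_lt_0_compat; lra).
assert (E1 : e1 * (K1 + K2) = eps / 2) by (unfold e1; field; lra).
assert (E2 : e2 * (Cmod A + Cmod B + 1) = eps / 2) by (unfold e2; field; lra).
destruct (Hf e1 He1) as (d3 & Hd3 & Hf').
destruct (Hu e2 He2) as (d4 & Hd4 & Hu').
destruct (Hv e2 He2) as (d5 & Hd5 & Hv').
(* Since [N < 2 * d6], both [K1 * N] and [K2 * N] stay below [d3], the radius on which the expansion
   of [f] holds. *)
set (d6 := d3 / (2 * (K1 + K2))).
assert (Hd6 : 0 < d6) by (apply Rdiv_lt_0_compat; lra).
assert (E6 : d6 * (K1 + K2) = d3 / 2) by (unfold d6; field; lra).
exists (Rmin d6 (Rmin (Rmin d1 d2) (Rmin d4 d5))); split.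
{ repeat apply Rmin_glb_lt; assumption. }
intros x y Hx Hy.
pose proof (Rmin_l d6 (Rmin (Rmin d1 d2) (Rmin d4 d5))).
pose proof (Rmin_r d6 (Rmin (Rmin d1 d2) (Rmin d4 d5))).
pose proof (Rmin_l (Rmin d1 d2) (Rmin d4 d5)).
pose proof (Rmin_r (Rmin d1 d2) (Rmin d4 d5)).
pose proof (Rmin_l d1 d2); pose proof (Rmin_r d1 d2).
pose proof (Rmin_l d4 d5); pose proof (Rmin_r d4 d5).
specialize (Lu x y ltac:(lra) ltac:(lra)).
specialize (Lv x y ltac:(lra) ltac:(lra)).
specialize (Hu' x y ltac:(lra) ltac:(lra)).
specialize (Hv' x y ltac:(lra) ltac:(lra)).
pose proof (Cmod_ge_0 (x - fst p)) as Nx; pose proof (Cmod_ge_0 (y - snd p)) as Ny.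
set (N := Cmod (x - fst p) + Cmod (y - snd p)) in *.
assert (HN : 0 <= N < 2 * d6) by (unfold N; lra).
assert (Cmod (u (x, y) - u p) < d3) as Hu3 by nra.
assert (Cmod (v (x, y) - v p) < d3) as Hv3 by nra.
specialize (Hf' (u (x, y)) (v (x, y)) Hu3 Hv3); cbn [fst snd] in Hf'.
set (ru := (u (x, y) - u p - a1 * (x - fst p) - b1 * (y - snd p))%C) in *.
set (rv := (v (x, y) - v p - a2 * (x - fst p) - b2 * (y - snd p))%C) in *.
set (rf := (f (u (x, y), v (x, y)) - f (u p, v p) - A * (u (x, y) - u p)
  - B * (v (x, y) - v p))%C) in *.
match goal with |- Cmod ?w <= _ => replace w with (rf + (A * ru + B * rv))%C
  by (unfold rf, ru, rv; ring) end.
eapply Rle_trans; [apply Cmod_triangle|].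
pose proof (Cmod_triangle (A * ru) (B * rv)) as T; rewrite !Cmod_mult in T.
assert (Cmod rf <= eps / 2 * N).
{ eapply Rle_trans; [apply Hf'|].
  rewrite <- E1, Rmult_assoc; apply Rmult_le_compat_l; lra. }
assert (Cmod A * Cmod ru <= Cmod A * (e2 * N)) by (apply Rmult_le_compat_l; lra).
assert (Cmod B * Cmod rv <= Cmod B * (e2 * N)) by (apply Rmult_le_compat_l; lra).
assert (0 <= e2 * N) by (apply Rmult_le_pos; lra).
assert (Cmod A * (e2 * N) + Cmod B * (e2 * N) <= eps / 2 * N)
  by (rewrite <- E2; nra).
lra.
Qed.

Lemma cdiff2_affine (A B D : C) (p : C * C) :
  cdiff2 (fun z => A * fst z + B * snd z + D)%C p.
Proof.
exists A, B; intros eps Heps; exists 1; split; [lra|]; intros x y _ _; cbn [fst snd].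
match goal with |- Cmod ?w <= _ => replace w with (RtoC 0) by ring end.
rewrite Cmod_0; pose proof (Cmod_ge_0 (x - fst p)); pose proof (Cmod_ge_0 (y - snd p)).
nra.
Qed.

Lemma cdiff2_ext_loc (f g : C * C -> C) (p : C * C) (r : R) : 0 < r ->
  (forall x y, Cmod (x - fst p) < r -> Cmod (y - snd p) < r -> f (x, y) = g (x, y)) ->
  cdiff2 f p -> cdiff2 g p.
Proof.
intros Hr E (A & B & H); exists A, B; intros eps Heps.
destruct (H eps Heps) as (dl & Hdl & Hf); exists (Rmin r dl); split.
{ now apply Rmin_glb_lt. }
intros x y Hx Hy; pose proof (Rmin_l r dl); pose proof (Rmin_r r dl).
rewrite <- E by lra.
replace (g p) with (f p); [apply Hf; lra|].
destruct p as [p1 p2]; apply E; cbn [fst snd];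
  [replace (p1 - p1)%C with (RtoC 0) by ring | replace (p2 - p2)%C with (RtoC 0) by ring];
  now rewrite Cmod_0.
Qed.

Lemma cdiff2_ext (f g : C * C -> C) (p : C * C) :
  (forall z, f z = g z) -> cdiff2 f p -> cdiff2 g p.
Proof. intros E; apply (cdiff2_ext_loc f g p 1); auto; lra. Qed.

Lemma cdiff2_const (D : C) (p : C * C) : cdiff2 (fun _ => D) p.
Proof.
apply (cdiff2_ext (fun z => 0 * fst z + 0 * snd z + D)%C);
  [intros; ring | apply cdiff2_affine].
Qed.

Lemma cdiff2_fst (p : C * C) : cdiff2 fst p.
Proof.
apply (cdiff2_ext (fun z => 1 * fst z + 0 * snd z + 0)%C);
  [intros; ring | apply cdiff2_affine].
Qed.

Lemma cdiff2_snd (p : C * C) : cdiff2 snd p.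
Proof.
apply (cdiff2_ext (fun z => 0 * fst z + 1 * snd z + 0)%C);
  [intros; ring | apply cdiff2_affine].
Qed.

Lemma cdiff2_plus (f g : C * C -> C) (p : C * C) :
  cdiff2 f p -> cdiff2 g p -> cdiff2 (fun z => f z + g z)%C p.
Proof.
intros Hf Hg.
apply (cdiff2_ext (fun z => 1 * f z + 1 * g z + 0)%C); [intros; ring|].
exact (cdiff2_comp _ f g p (cdiff2_affine 1 1 0 _) Hf Hg).
Qed.

Lemma cdiff2_mult (f g : C * C -> C) (p : C * C) :
  cdiff2 f p -> cdiff2 g p -> cdiff2 (fun z => f z * g z)%C p.
Proof.
intros Hf Hg; apply (cdiff2_comp (fun z => fst z * snd z)%C f g p); auto.
exists (g p), (f p); intros eps Heps; exists eps; split; [assumption|].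
intros x y Hx Hy; cbn [fst snd] in *.
match goal with |- Cmod ?w <= _ => replace w with ((x - f p) * (y - g p))%C by ring end.
rewrite Cmod_mult; pose proof (Cmod_ge_0 (x - f p)); pose proof (Cmod_ge_0 (y - g p)).
nra.
Qed.

Lemma cdiff2_pow (f : C * C -> C) (p : C * C) (n : nat) :
  cdiff2 f p -> cdiff2 (fun z => f z ^ n)%C p.
Proof.
intros Hf; induction n as [|n IH].
- apply (cdiff2_ext (fun _ => RtoC 1)); [reflexivity | apply cdiff2_const].
- apply (cdiff2_ext (fun z => f z * f z ^ n)%C); [intros; now rewrite Cpow_S|].
  now apply cdiff2_mult.
Qed.

Lemma Cinv_remainder (x x0 : C) : x <> 0 -> x0 <> 0 ->
  (/ x - / x0 - (- (/ x0 * / x0)) * (x - x0) = (x - x0) * (x - x0) * (/ x * (/ x0 * / x0)))%C.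
Proof. intros; field; auto. Qed.

Lemma cdiff2_inv (f : C * C -> C) (p : C * C) :
  f p <> 0 -> cdiff2 f p -> cdiff2 (fun z => / f z)%C p.
Proof.
intros H0 Hf.
apply (cdiff2_comp (fun z => / fst z)%C f f p); auto.
set (c := f p) in *.
exists (- (/ c * / c))%C, (RtoC 0); intros eps Heps; cbn [fst snd].
assert (Hc : 0 < Cmod c) by now apply Cmod_gt_0.
set (m := Cmod c) in *.
(* The first bound gives [Cmod x > m / 2], so the exact remainder is at most [2 / m^3] times the
   square of [Cmod (x - c)]; the second bound turns this into [eps * Cmod (x - c)]. *)
exists (Rmin (m / 2) (eps * (m * m * m / 2))); split.
{ apply Rmin_glb_lt; [lra|]; repeat apply Rmult_lt_0_compat; lra. }
intros x y Hx _.
pose proof (Rmin_l (m / 2) (eps * (m * m * m / 2))).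
pose proof (Rmin_r (m / 2) (eps * (m * m * m / 2))).
pose proof (Cmod_le_minus c x) as T; rewrite (Cmod_minus_sym c x) in T; fold m in T.
assert (Hx2 : m / 2 < Cmod x) by lra.
assert (Hx0 : x <> 0) by (apply Cmod_gt_0; lra).
replace (/ x - / c - - (/ c * / c) * (x - c) - 0 * (y - c))%C
  with ((x - c) * (x - c) * (/ x * (/ c * / c)))%C
  by (rewrite <- Cinv_remainder by auto; ring).
rewrite !Cmod_mult, !Cmod_inv by auto; fold m.
set (N := Cmod (x - c)) in *.
assert (0 <= N) by apply Cmod_ge_0; pose proof (Cmod_ge_0 (y - c)).
assert (Hi : / Cmod x <= 2 / m).
{ replace (2 / m) with (/ (m / 2)) by (field; lra); apply Rinv_le_contravar; lra. }
assert (0 < / m) by (now apply Rinv_0_lt_compat).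
assert (0 < / Cmod x) by (apply Rinv_0_lt_compat; lra).
apply Rle_trans with (N * (eps * (m * m * m / 2)) * (2 / m * (/ m * / m))).
- apply Rmult_le_compat; [nra|apply Rmult_le_pos; nra|nra|].
  apply Rmult_le_compat_r; nra.
- replace (N * (eps * (m * m * m / 2)) * (2 / m * (/ m * / m))) with (eps * N)
    by (field; lra).
  nra.
Qed.

(** The balls of the uniform structure on [C] are squares; they compare with the discs of [Cmod] up
    to a factor [sqrt 2]. Everything after this is phrased with polydiscs. *)
Lemma locally_C2 (p : C * C) (P : C * C -> Prop) :
  locally (p : C2) P <-> exists r : R, 0 < r /\
    forall x y, Cmod (x - fst p) < r -> Cmod (y - snd p) < r -> P (x, y).
Proof.
split.
- intros [e He]; exists e; split; [apply cond_pos|].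
  intros x y Hx Hy; apply He; split; now apply C_NormedModule_mixin_compat1.
- intros (r & Hr & H).
  assert (Hs : 0 < sqrt 2) by (apply sqrt_lt_R0; lra).
  assert (Hr' : 0 < r / sqrt 2) by now apply Rdiv_lt_0_compat.
  exists (mkposreal _ Hr'); intros [x y] [Bx By]; cbn [fst snd] in *.
  apply C_NormedModule_mixin_compat2 in Bx; apply C_NormedModule_mixin_compat2 in By.
  cbn [pos] in Bx, By.
  replace (sqrt 2 * (r / sqrt 2)) with r in Bx, By by (field; lra).
  now apply H.
Qed.

(** A linear form is determined by its values on the two basis vectors, and the Euclidean norm of
    [C2] lies between half the sum of the two moduli and that sum. *)
Lemma cdiff2_filterdiff (f : C * C -> C) (p : C * C) :
  @ex_filterdiff C_AbsRing C2 C_NormedModule f (locally (p : C2)) <-> cdiff2 f p.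
Proof.
assert (Hn : forall z : C2, norm z = sqrt (Cmod (fst z) ^ 2 + Cmod (snd z) ^ 2)) by reflexivity.
assert (Hn1 : forall z : C2, Cmod (fst z) + Cmod (snd z) <= 2 * norm z).
{ intros z; rewrite Hn.
  pose proof (Cmod_ge_0 (fst z)); pose proof (Cmod_ge_0 (snd z)).
  assert (Cmod (fst z) <= sqrt (Cmod (fst z) ^ 2 + Cmod (snd z) ^ 2)).
  { rewrite <- (sqrt_pow2 (Cmod (fst z))) at 1 by auto; apply sqrt_le_1_alt; nra. }
  assert (Cmod (snd z) <= sqrt (Cmod (fst z) ^ 2 + Cmod (snd z) ^ 2)).
  { rewrite <- (sqrt_pow2 (Cmod (snd z))) at 1 by auto; apply sqrt_le_1_alt; nra. }
  lra. }
assert (Hn2 : forall z : C2, norm z <= Cmod (fst z) + Cmod (snd z)).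
{ intros z; rewrite Hn.
  pose proof (Cmod_ge_0 (fst z)); pose proof (Cmod_ge_0 (snd z)).
  rewrite <- (sqrt_pow2 (Cmod (fst z) + Cmod (snd z))) by lra.
  apply sqrt_le_1_alt; nra. }
split.
- intros (l & Hl & Hd).
  specialize (Hd p (fun P HP => HP)).
  exists (l (RtoC 1, RtoC 0)), (l (RtoC 0, RtoC 1)); intros eps Heps.
  specialize (Hd (mkposreal eps Heps)).
  apply locally_C2 in Hd; destruct Hd as (r & Hr & Hd).
  exists r; split; auto; intros x y Hx Hy; specialize (Hd x y Hx Hy); cbn [pos] in Hd.
  set (dx := (x - fst p)%C) in *; set (dy := (y - snd p)%C) in *.
  replace (@minus (NormedModule.AbelianGroup _ C2) (x, y) p)
    with ((dx, dy) : C2) in Hd by reflexivity.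
  assert (El : l (dx, dy) = (l (RtoC 1, RtoC 0) * dx + l (RtoC 0, RtoC 1) * dy)%C).
  { replace ((dx, dy) : C2) with (plus (scal (dx : C_AbsRing) ((RtoC 1, RtoC 0) : C2))
       (scal (dy : C_AbsRing) ((RtoC 0, RtoC 1) : C2))).
    - rewrite (linear_plus _ Hl), !(linear_scal _ Hl).
      change (dx * l (RtoC 1, RtoC 0) + dy * l (RtoC 0, RtoC 1) =
        l (RtoC 1, RtoC 0) * dx + l (RtoC 0, RtoC 1) * dy)%C; ring.
    - change (((dx * 1 + dy * 0)%C, (dx * 0 + dy * 1)%C) = (dx, dy)); f_equal; ring. }
  rewrite El in Hd.
  replace (f (x, y) - f p - l (RtoC 1, RtoC 0) * dx - l (RtoC 0, RtoC 1) * dy)%C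
    with (f (x, y) - f p - (l (RtoC 1, RtoC 0) * dx + l (RtoC 0, RtoC 1) * dy))%C by ring.
  eapply Rle_trans; [exact Hd|].
  apply Rmult_le_compat_l; [lra|]; apply Hn2.
- intros (A & B & H).
  exists (fun z => A * fst z + B * snd z)%C; split.
  + constructor.
    * intros u v; change (A * (fst u + fst v) + B * (snd u + snd v) =
        A * fst u + B * snd u + (A * fst v + B * snd v))%C; ring.
    * intros k u; change (A * (k * fst u) + B * (k * snd u) = k * (A * fst u + B * snd u))%C; ring.
    * pose proof (Cmod_ge_0 A); pose proof (Cmod_ge_0 B).
      exists (2 * (Cmod A + Cmod B + 1)); split; [lra|].
      intros z; change (Cmod (A * fst z + B * snd z) <= 2 * (Cmod A + Cmod B + 1) * norm z).
      eapply Rle_trans; [apply Cmod_triangle|]; rewrite !Cmod_mult.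
      pose proof (Hn1 z); pose proof (Cmod_ge_0 (fst z)); pose proof (Cmod_ge_0 (snd z)); nra.
  + intros p' Hp'.
    (* A filter differential quantifies over every limit point of the filter; here [p] is the only
       one. *)
    assert (p = p') as <- by exact (is_filter_lim_locally_unique _ _ Hp').
    intros eps; apply locally_C2.
    pose proof (cond_pos eps) as He.
    destruct (H (eps / 2) ltac:(lra)) as (dl & Hdl & Hf).
    exists dl; split; auto; intros x y Hx Hy; specialize (Hf x y Hx Hy).
    change (Cmod (f (x, y) - f p - (A * (x - fst p) + B * (y - snd p))) <=
      eps * norm (((x - fst p)%C, (y - snd p)%C) : C2)).
    pose proof (Hn1 (((x - fst p)%C, (y - snd p)%C) : C2)) as T; cbn [fst snd] in T.
    replace (f (x, y) - f p - (A * (x - fst p) + B * (y - snd p)))%C with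
      (f (x, y) - f p - A * (x - fst p) - B * (y - snd p))%C by ring.
    nra.
Qed.

Definition holo_on (r : R) (f : C * C -> C) : Prop :=
  forall x y, Cmod x < r -> Cmod y < r -> cdiff2 f (x, y).

Lemma locally_origin (P : C * C -> Prop) : locally origin P <->
  exists r : R, 0 < r /\ forall x y, Cmod x < r -> Cmod y < r -> P (x, y).
Proof.
unfold origin; rewrite (locally_C2 (RtoC 0, RtoC 0)); cbn [fst snd].
split; intros (r & Hr & H); exists r; split; auto; intros x y.
- intros Hx Hy; apply H; [replace (x - 0)%C with x by ring
    | replace (y - 0)%C with y by ring]; auto.
- replace (x - 0)%C with x by ring; replace (y - 0)%C with y by ring; apply H.
Qed.

Lemma holomorphic_germ_iff (f : C * C -> C) :
  holomorphic_germ f <-> exists r : R, 0 < r /\ holo_on r f.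
Proof.
unfold holomorphic_germ; rewrite locally_origin; unfold holo_on.
split; intros (r & Hr & H); exists r; split; auto; intros x y Hx Hy;
  apply cdiff2_filterdiff; auto.
Qed.

(** * Integrals of complex-valued functions of a real variable *)

(** The point is the supremum of the left ends, of which every right end is an upper bound. *)
Lemma nested_intervals (a h : nat -> R) :
  (forall n, a n <= a (S n)) -> (forall n, a (S n) + h (S n) <= a n + h n) ->
  (forall n, 0 <= h n) -> exists s, forall n, a n <= s <= a n + h n.
Proof.
intros Ha Hh H0.
assert (Ma : forall n m, (n <= m)%nat -> a n <= a m).
{ intros n m; induction 1 as [|m _ IH]; [lra | specialize (Ha m); lra]. }
assert (Mh : forall n m, (n <= m)%nat -> a m + h m <= a n + h n).
{ intros n m; induction 1 as [|m _ IH]; [lra | specialize (Hh m); lra]. }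
assert (B : forall n m, a m <= a n + h n).
{ intros n m; destruct (Nat.le_ge_cases n m) as [L|L].
  - specialize (Mh n m L); specialize (H0 m); lra.
  - specialize (Ma m n L); specialize (H0 n); lra. }
destruct (completeness (fun x => exists n, x = a n)) as [s [U L]].
- exists (a 0%nat + h 0%nat); intros x [n ->]; apply B.
- now exists (a 0%nat), 0%nat.
- exists s; intros n; split; [apply U; now exists n|].
  apply L; intros x [m ->]; apply B.
Qed.

(** * Vanishing of an additive function of squares, by bisection *)

Section Bisection.
Variable (I : R -> R -> R -> C).
Definition in_unit_square (a c h : R) : Prop :=
  0 <= a /\ 0 <= c /\ 0 < h /\ a + h <= 1 /\ c + h <= 1.
Hypothesis HI : forall a c h, in_unit_square a c h ->
  I a c h = (I a c (h / 2) + I (a + h / 2) c (h / 2)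
             + I a (c + h / 2) (h / 2) + I (a + h / 2) (c + h / 2) (h / 2))%C.
Hypothesis Hloc : forall s t, 0 <= s <= 1 -> 0 <= t <= 1 -> forall eps, 0 < eps ->
  exists dl, 0 < dl /\ forall a c h, in_unit_square a c h -> h < dl ->
    a <= s <= a + h -> c <= t <= c + h -> Cmod (I a c h) <= eps * (h * h).

Let large (e a c h : R) : Prop := e * (h * h) <= Cmod (I a c h).

(** Chooses the corner of a quarter on which the ratio of [Cmod I] to the area is still at least
    [e]. The fourth quarter is the default: if the other three fail, the triangle inequality forces
    this one to succeed. *)
Let quarter (e h : R) (p : R * R) : R * R :=
  let k := h / 2 in
  if Rle_dec (e * (k * k)) (Cmod (I (fst p) (snd p) k)) then p
  else if Rle_dec (e * (k * k)) (Cmod (I (fst p + k) (snd p) k)) then (fst p + k, snd p)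
  else if Rle_dec (e * (k * k)) (Cmod (I (fst p) (snd p + k) k)) then (fst p, snd p + k)
  else (fst p + k, snd p + k).

Let quarter_spec (e h : R) (p : R * R) : in_unit_square (fst p) (snd p) h ->
  large e (fst p) (snd p) h ->
  large e (fst (quarter e h p)) (snd (quarter e h p)) (h / 2) /\
  (fst p <= fst (quarter e h p) <= fst p + h / 2) /\
  (snd p <= snd (quarter e h p) <= snd p + h / 2).
Proof.
intros U L; pose proof (HI _ _ _ U) as E; destruct U as (? & ? & ? & ? & ?).
unfold quarter, large in *.
destruct (Rle_dec _ _) as [L1|N1]; [cbn [fst snd]; repeat split; lra|].
destruct (Rle_dec _ _) as [L2|N2]; [cbn [fst snd]; repeat split; lra|].
destruct (Rle_dec _ _) as [L3|N3]; [cbn [fst snd]; repeat split; lra|].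
cbn [fst snd]; repeat split; try lra.
rewrite E in L.
set (k := h / 2) in *; replace h with (2 * k) in L by (unfold k; field).
set (I1 := I (fst p) (snd p) k) in *; set (I2 := I (fst p + k) (snd p) k) in *.
set (I3 := I (fst p) (snd p + k) k) in *; set (I4 := I (fst p + k) (snd p + k) k) in *.
pose proof (Cmod_triangle (I1 + I2 + I3) I4); pose proof (Cmod_triangle (I1 + I2) I3).
pose proof (Cmod_triangle I1 I2); lra.
Qed.

(** If [e], the modulus of [I 0 0 1], were positive, repeated quartering would give squares of side
    [(1/2)^n] with [Cmod I >= e * h^2], shrinking to a point [(s, t)]. There [Hloc] with [e / 2] is
    violated. *)
Lemma bisection_zero : I 0 0 1 = 0%C.
Proof.
destruct (Ceq_dec (I 0 0 1) 0) as [|N]; [assumption|exfalso].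
set (e := Cmod (I 0 0 1)).
assert (He : 0 < e) by now apply Cmod_gt_0.
set (h := fun n => (/ 2) ^ n).
set (p := fix p n := match n with O => (0, 0) | S m => quarter e (h m) (p m) end).
assert (Hh : forall n, 0 < h n) by (intros n; apply pow_lt; lra).
assert (HS : forall n, h (S n) = h n / 2) by (intros n; unfold h; simpl; field).
assert (Inv : forall n, in_unit_square (fst (p n)) (snd (p n)) (h n) /\
   large e (fst (p n)) (snd (p n)) (h n)).
{ induction n as [|n [U L]].
  - unfold in_unit_square, large, h, e; simpl; repeat split; lra.
  - destruct (quarter_spec e (h n) (p n) U L) as (L' & Q1 & Q2).
    change (quarter e (h n) (p n)) with (p (S n)) in *; rewrite HS.
    split; [|exact L']; destruct U as (? & ? & ? & ? & ?).
    unfold in_unit_square; repeat split; lra. }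
assert (Q : forall n, (fst (p n) <= fst (p (S n)) <= fst (p n) + h n / 2) /\
  (snd (p n) <= snd (p (S n)) <= snd (p n) + h n / 2)).
{ intros n; destruct (Inv n) as [U L].
  exact (proj2 (quarter_spec e (h n) (p n) U L)). }
destruct (nested_intervals (fun n => fst (p n)) h) as [s Hs].
1,2: intros n; specialize (Q n); rewrite ?HS; lra.
{ intros n; left; apply Hh. }
destruct (nested_intervals (fun n => snd (p n)) h) as [t Ht].
1,2: intros n; specialize (Q n); rewrite ?HS; lra.
{ intros n; left; apply Hh. }
pose proof (Hs 0%nat) as Hs0; pose proof (Ht 0%nat) as Ht0; unfold h in Hs0, Ht0; simpl in Hs0, Ht0.
destruct (Hloc s t ltac:(lra) ltac:(lra) (e / 2) ltac:(lra)) as (dl & Hdl & H).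
destruct (pow_lt_1_zero (/ 2)) with (y := dl) as [n Hn]; auto.
{ rewrite Rabs_pos_eq; lra. }
specialize (Hn n (le_n n)); rewrite Rabs_pos_eq in Hn by (left; apply Hh).
destruct (Inv n) as [U L]; specialize (H _ _ _ U Hn (Hs n) (Ht n)).
unfold large in L; specialize (Hh n); assert (0 < h n * h n) by nra; nra.
Qed.
End Bisection.

(** * Continuous paths and their integrals *)

Definition ccont (f : R -> C) (t : R) : Prop :=
  forall eps, 0 < eps -> exists dl, 0 < dl /\
    forall s, Rabs (s - t) < dl -> Cmod (f s - f t) <= eps.

Lemma ccont_continuous (f : R -> C) (t : R) :
  ccont f t -> @continuous R_UniformSpace C_UniformSpace f t.
Proof.
intros H P [e He]; pose proof (cond_pos e).
destruct (H (e / 2) ltac:(lra)) as (dl & Hdl & Hf).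
exists (mkposreal dl Hdl); intros s Hs; apply He.
apply C_NormedModule_mixin_compat1.
change (Cmod (f s - f t) < e).
apply Rle_lt_trans with (e / 2); [apply Hf; exact Hs | lra].
Qed.

Lemma ccont_components (f : R -> C) (t : R) :
  continuous (fun x => fst (f x)) t -> continuous (fun x => snd (f x)) t -> ccont f t.
Proof.
intros H1 H2 e He.
assert (Hs : 0 < sqrt 2) by (apply sqrt_lt_R0; lra).
assert (He2 : 0 < e / sqrt 2) by now apply Rdiv_lt_0_compat.
destruct (proj1 (filterlim_locally _ _) H1 (mkposreal _ He2)) as [d1 D1].
destruct (proj1 (filterlim_locally _ _) H2 (mkposreal _ He2)) as [d2 D2].
exists (Rmin d1 d2); split; [apply Rmin_glb_lt; apply cond_pos|].
intros s Hs'.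
pose proof (Rmin_l d1 d2); pose proof (Rmin_r d1 d2).
assert (B : ball (f t) (mkposreal _ He2) (f s)).
{ split; [apply D1 | apply D2]; change (Rabs (s - t) < d1) || change (Rabs (s - t) < d2); lra. }
apply C_NormedModule_mixin_compat2 in B; cbn [pos] in B.
change (Cmod (f s - f t) < sqrt 2 * (e / sqrt 2)) in B.
replace (sqrt 2 * (e / sqrt 2)) with e in B by (field; lra); lra.
Qed.

(** Sums, products, inverses and powers of paths are composites with complex differentiable
    functions, so their continuity reduces to this Lipschitz argument. *)
Lemma ccont_comp (f : C * C -> C) (u v : R -> C) (t : R) :
  cdiff2 f (u t, v t) -> ccont u t -> ccont v t -> ccont (fun x => f (u x, v x)) t.
Proof.
intros Hf Hu Hv e He.
destruct (cdiff2_lipschitz f _ Hf) as (K & d & HK & Hd & L); cbn [fst snd] in L.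
set (e' := Rmin (d / 2) (e / (2 * K))).
assert (He1 : 0 < e / (2 * K)) by (apply Rdiv_lt_0_compat; lra).
assert (He' : 0 < e') by (apply Rmin_glb_lt; lra).
destruct (Hu e' He') as (d1 & Hd1 & H1); destruct (Hv e' He') as (d2 & Hd2 & H2).
exists (Rmin d1 d2); split; [now apply Rmin_glb_lt|]; intros s Hs.
pose proof (Rmin_l d1 d2); pose proof (Rmin_r d1 d2).
specialize (H1 s ltac:(lra)); specialize (H2 s ltac:(lra)).
pose proof (Rmin_l (d / 2) (e / (2 * K))); pose proof (Rmin_r (d / 2) (e / (2 * K))).
fold e' in H3, H4.
eapply Rle_trans; [apply L; lra|].
replace e with (K * (e / (2 * K) + e / (2 * K))) by (field; lra).
apply Rmult_le_compat_l; lra.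
Qed.

Lemma ccont_const (c : C) (t : R) : ccont (fun _ => c) t.
Proof.
intros e He; exists 1; split; [lra|]; intros s _.
replace (c - c)%C with (RtoC 0) by ring; rewrite Cmod_0; lra.
Qed.

Lemma ccont_plus (f g : R -> C) (t : R) :
  ccont f t -> ccont g t -> ccont (fun x => f x + g x)%C t.
Proof.
apply (ccont_comp (fun p => fst p + snd p)%C).
apply cdiff2_plus; [apply cdiff2_fst | apply cdiff2_snd].
Qed.

Lemma ccont_mult (f g : R -> C) (t : R) :
  ccont f t -> ccont g t -> ccont (fun x => f x * g x)%C t.
Proof.
apply (ccont_comp (fun p => fst p * snd p)%C).
apply cdiff2_mult; [apply cdiff2_fst | apply cdiff2_snd].
Qed.

Lemma ccont_minus (f g : R -> C) (t : R) :
  ccont f t -> ccont g t -> ccont (fun x => f x - g x)%C t.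
Proof.
apply (ccont_comp (fun p => fst p - snd p)%C).
apply (cdiff2_ext (fun p => 1 * fst p + (- (1)) * snd p + 0)%C);
  [intros; ring | apply cdiff2_affine].
Qed.

Lemma ccont_inv (f : R -> C) (t : R) :
  f t <> 0%C -> ccont f t -> ccont (fun x => / f x)%C t.
Proof.
intros H Hf; apply (ccont_comp (fun p => / fst p)%C f f t); auto.
apply cdiff2_inv; [exact H | apply cdiff2_fst].
Qed.

Lemma ccont_pow (f : R -> C) (t : R) (n : nat) :
  ccont f t -> ccont (fun x => f x ^ n)%C t.
Proof.
intros Hf; apply (ccont_comp (fun p => fst p ^ n)%C f f t); auto.
apply cdiff2_pow, cdiff2_fst.
Qed.

Definition is_CI (f : R -> C) (a b : R) (l : C) : Prop :=
  @is_RInt C_R_NormedModule f a b l.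

(** Total, with a meaning only for integrable [f]; computations therefore go through [is_CI], and
    [CI_correct] is the link for continuous integrands. *)
Definition CI (f : R -> C) (a b : R) : C := @RInt C_R_CompleteNormedModule f a b.

Lemma CI_correct (f : R -> C) (a b : R) : a <= b ->
  (forall t, a <= t <= b -> ccont f t) -> is_CI f a b (CI f a b).
Proof.
intros Hab H; apply (@RInt_correct C_R_CompleteNormedModule).
apply ex_RInt_continuous; intros t Ht; rewrite Rmin_left, Rmax_right in Ht by lra.
now apply ccont_continuous, H.
Qed.

Lemma is_CI_unique (f : R -> C) (a b : R) (l : C) : is_CI f a b l -> CI f a b = l.
Proof. exact (@is_RInt_unique C_R_CompleteNormedModule f a b l). Qed.

Lemma is_CI_plus (f g : R -> C) (a b : R) (k l : C) :
  is_CI f a b k -> is_CI g a b l -> is_CI (fun t => f t + g t)%C a b (k + l)%C.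
Proof. exact (@is_RInt_plus C_R_NormedModule f g a b k l). Qed.

Lemma is_CI_minus (f g : R -> C) (a b : R) (k l : C) :
  is_CI f a b k -> is_CI g a b l -> is_CI (fun t => f t - g t)%C a b (k - l)%C.
Proof. exact (@is_RInt_minus C_R_NormedModule f g a b k l). Qed.

(** The integral takes values in [C] as a real normed module, so linearity over complex scalars is
    checked on real and imaginary parts. *)
Lemma is_CI_scal (f : R -> C) (a b : R) (c l : C) :
  is_CI f a b l -> is_CI (fun t => c * f t)%C a b (c * l)%C.
Proof.
intros H.
pose proof (is_RInt_fct_extend_fst (U := R_NormedModule) (V := R_NormedModule) f a b l H) as H1.
pose proof (is_RInt_fct_extend_snd (U := R_NormedModule) (V := R_NormedModule) f a b l H) as H2.
apply (is_RInt_fct_extend_pair (U := R_NormedModule) (V := R_NormedModule)); cbn.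
- exact (is_RInt_minus _ _ _ _ _ _ (is_RInt_scal _ _ _ (fst c) _ H1)
    (is_RInt_scal _ _ _ (snd c) _ H2)).
- exact (is_RInt_plus _ _ _ _ _ _ (is_RInt_scal _ _ _ (fst c) _ H2)
    (is_RInt_scal _ _ _ (snd c) _ H1)).
Qed.

Lemma is_CI_const (a b : R) (c : C) : is_CI (fun _ => c) a b ((b - a)%R * c)%C.
Proof.
replace ((b - a)%R * c)%C with (@scal R_AbsRing C_R_NormedModule (b - a) c).
- exact (@is_RInt_const C_R_NormedModule a b c).
- destruct c as [x y]; unfold RtoC, Cmult; cbn.
  unfold prod_scal; cbn; unfold scal; cbn; unfold mult; cbn; f_equal; ring.
Qed.

Lemma is_CI_ext (f g : R -> C) (a b : R) (l : C) : a <= b ->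
  (forall t, a <= t <= b -> f t = g t) -> is_CI f a b l -> is_CI g a b l.
Proof.
intros Hab E; apply is_RInt_ext; intros t Ht.
rewrite Rmin_left, Rmax_right in Ht by lra; apply E; lra.
Qed.

Lemma is_CI_bound (f : R -> C) (a b : R) (l : C) (M : R) : a <= b ->
  (forall t, a <= t <= b -> Cmod (f t) <= M) -> is_CI f a b l -> Cmod l <= (b - a) * M.
Proof.
intros Hab HM H; rewrite Cmod_norm.
apply (@norm_RInt_le_const C_R_NormedModule f a b l M); auto.
intros t Ht; rewrite <- Cmod_norm; auto.
Qed.

Lemma CI_Chasles (f : R -> C) (a b c : R) : a <= b <= c ->
  (forall t, a <= t <= c -> ccont f t) -> CI f a c = (CI f a b + CI f b c)%C.
Proof.
intros Hab H; apply is_CI_unique.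
apply (@is_RInt_Chasles C_R_NormedModule f a b c); apply CI_correct; try lra;
  intros; apply H; lra.
Qed.

Definition cderiv (g : R -> C) (t : R) (l : C) : Prop :=
  is_derive (fun x => fst (g x)) t (fst l) /\ is_derive (fun x => snd (g x)) t (snd l).

Lemma cderiv_ccont (g : R -> C) (t : R) (l : C) : cderiv g t l -> ccont g t.
Proof.
intros [H1 H2]; apply ccont_components.
- apply (ex_derive_continuous (V := R_NormedModule)); eexists; exact H1.
- apply (ex_derive_continuous (V := R_NormedModule)); eexists; exact H2.
Qed.

Lemma cderiv_const (c : C) (t : R) : cderiv (fun _ => c) t 0%C.
Proof. split; apply is_derive_Reals, derivable_pt_lim_const. Qed.

Lemma cderiv_plus (f g : R -> C) (t : R) (k l : C) :
  cderiv f t k -> cderiv g t l -> cderiv (fun x => f x + g x)%C t (k + l)%C.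
Proof.
intros [F1 F2] [G1 G2]; split; cbn.
- exact (is_derive_plus _ _ _ _ _ F1 G1).
- exact (is_derive_plus _ _ _ _ _ F2 G2).
Qed.

Lemma cderiv_mult (f g : R -> C) (t : R) (k l : C) :
  cderiv f t k -> cderiv g t l -> cderiv (fun x => f x * g x)%C t (k * g t + f t * l)%C.
Proof.
intros [F1 F2] [G1 G2]; split; cbn.
- evar_last.
  + apply (is_derive_minus (V := R_NormedModule)).
    * apply (is_derive_mult _ _ _ _ _ F1 G1); intros; apply Rmult_comm.
    * apply (is_derive_mult _ _ _ _ _ F2 G2); intros; apply Rmult_comm.
  + unfold minus, plus, opp, mult; cbn; ring.
- evar_last.
  + apply (is_derive_plus (V := R_NormedModule)).
    * apply (is_derive_mult _ _ _ _ _ F1 G2); intros; apply Rmult_comm.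
    * apply (is_derive_mult _ _ _ _ _ F2 G1); intros; apply Rmult_comm.
  + unfold minus, plus, opp, mult; cbn; ring.
Qed.

Lemma is_CI_cderiv (g dg : R -> C) (a b : R) : a <= b ->
  (forall t, a <= t <= b -> cderiv g t (dg t)) ->
  (forall t, a <= t <= b -> ccont dg t) -> is_CI dg a b (g b - g a)%C.
Proof.
intros Hab Hd Hc.
pose proof (CI_correct dg a b Hab Hc) as H.
pose proof (is_RInt_fct_extend_fst (U := R_NormedModule) (V := R_NormedModule) _ a b _ H) as H1.
pose proof (is_RInt_fct_extend_snd (U := R_NormedModule) (V := R_NormedModule) _ a b _ H) as H2.
assert (Cc : forall t, a <= t <= b -> continuous (fun x => fst (dg x)) t /\
                                      continuous (fun x => snd (dg x)) t).
{ intros t Ht; pose proof (ccont_continuous _ _ (Hc t Ht)) as K; split.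
  - apply (continuous_comp (V := C_UniformSpace) dg fst); [exact K|].
    apply (continuous_fst (U := R_UniformSpace) (V := R_UniformSpace)).
  - apply (continuous_comp (V := C_UniformSpace) dg snd); [exact K|].
    apply (continuous_snd (U := R_UniformSpace) (V := R_UniformSpace)). }
apply (is_RInt_fct_extend_pair (U := R_NormedModule) (V := R_NormedModule)).
- apply (is_RInt_derive (V := R_CompleteNormedModule) (fun t => fst (g t)));
    intros t Ht; rewrite Rmin_left, Rmax_right in Ht by lra; [now apply Hd | now apply Cc].
- apply (is_RInt_derive (V := R_CompleteNormedModule) (fun t => snd (g t)));
    intros t Ht; rewrite Rmin_left, Rmax_right in Ht by lra; [now apply Hd | now apply Cc].
Qed.

(** * Goursat's theorem *)

(** One variable is treated as two with a dummy second one, so that the rules proved for [cdiff2]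
    apply unchanged. *)
Definition cdiff (F : C -> C) (z : C) : Prop := cdiff2 (fun p => F (fst p)) (z, RtoC 0).

Lemma ccont_cdiff (F : C -> C) (g : R -> C) (t : R) :
  cdiff F (g t) -> ccont g t -> ccont (fun x => F (g x)) t.
Proof.
intros HF Hg; apply (ccont_comp (fun p => F (fst p)) g (fun _ => RtoC 0) t); auto.
apply ccont_const.
Qed.

Lemma cdiff_expand (F : C -> C) (z : C) : cdiff F z ->
  exists A, forall eps, 0 < eps -> exists dl, 0 < dl /\ forall w, Cmod (w - z) < dl ->
    Cmod (F w - F z - A * (w - z)) <= eps * Cmod (w - z).
Proof.
intros (A & B & H); exists A; intros eps He.
destruct (H eps He) as (dl & Hdl & Hf); exists dl; split; auto; intros w Hw.
cbn [fst snd] in Hf.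
assert (E0 : (0 - 0 = 0)%C) by ring.
specialize (Hf w 0%C Hw); rewrite E0, Cmod_0, Rplus_0_r in Hf.
replace (F w - F z - A * (w - z))%C with (F w - F z - A * (w - z) - B * 0)%C by ring.
now apply Hf.
Qed.

(** [G] is a primitive of the affine function [A + B z]; along the path only the deviation of [F]
    from it is left to integrate. *)
Lemma edge_bound (F : C -> C) (g dg : R -> C) (a b K M : R) (A B : C) : a <= b ->
  (forall t, a <= t <= b -> cderiv g t (dg t)) ->
  (forall t, a <= t <= b -> ccont dg t) ->
  (forall t, a <= t <= b -> ccont (fun t => F (g t)) t) ->
  (forall t, a <= t <= b -> Cmod (F (g t) - (A + B * g t)) <= K) ->
  (forall t, a <= t <= b -> Cmod (dg t) <= M) ->
  let G := fun z => (A * z + B / 2 * (z * z))%C in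
  Cmod (CI (fun t => F (g t) * dg t)%C a b - (G (g b) - G (g a))) <= (b - a) * (K * M).
Proof.
intros Hab Hd Hc HF HK HM G.
assert (Cg : forall t, a <= t <= b -> ccont g t) by (intros t Ht; eapply cderiv_ccont, Hd, Ht).
assert (D2 : (2 : C) <> 0%C) by (intros E; apply (f_equal fst) in E; cbn in E; lra).
assert (H1 : is_CI (fun t => (A + B * g t) * dg t)%C a b (G (g b) - G (g a))%C).
{ apply (is_CI_cderiv (fun t => G (g t))); auto.
  - intros t Ht; unfold G.
    replace ((A + B * g t) * dg t)%C with
      ((0 * g t + A * dg t) + (0 * (g t * g t) + B / 2 * (dg t * g t + g t * dg t)))%C
      by (field; exact D2).
    apply cderiv_plus; apply cderiv_mult; auto using cderiv_const, cderiv_mult.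
  - intros t Ht; auto 8 using ccont_mult, ccont_plus, ccont_const. }
apply (is_CI_bound (fun t => F (g t) * dg t - (A + B * g t) * dg t)%C a b); auto.
- intros t Ht.
  replace (F (g t) * dg t - (A + B * g t) * dg t)%C with
    ((F (g t) - (A + B * g t)) * dg t)%C by ring.
  rewrite Cmod_mult; apply Rmult_le_compat; auto using Cmod_ge_0.
- apply is_CI_minus; auto; apply CI_correct; auto.
  intros t Ht; auto using ccont_mult.
Qed.

Section Goursat.
Variables (F : C -> C) (Phi Ps Pt : R -> R -> C) (M : R).
Hypothesis HM : 0 < M.
Hypothesis Hs : forall s t, cderiv (fun s => Phi s t) s (Ps s t).
Hypothesis Ht : forall s t, cderiv (fun t => Phi s t) t (Pt s t).
Hypothesis Cs : forall s t, ccont (fun s => Ps s t) s.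
Hypothesis Ct : forall s t, ccont (fun t => Pt s t) t.
Hypothesis Bs : forall s t, 0 <= s <= 1 -> 0 <= t <= 1 -> Cmod (Ps s t) <= M.
Hypothesis Bt : forall s t, 0 <= s <= 1 -> 0 <= t <= 1 -> Cmod (Pt s t) <= M.
Hypothesis HF : forall s t, 0 <= s <= 1 -> 0 <= t <= 1 -> cdiff F (Phi s t).

Let P (t s : R) : C := (F (Phi s t) * Ps s t)%C.
Let Q (s t : R) : C := (F (Phi s t) * Pt s t)%C.

(** The integral of [F dz] along the image under [Phi] of the boundary of the square with lower left
    corner [(a, c)] and side [h], traversed counterclockwise in the [(s, t)] plane. *)
Definition square_integral (a c h : R) : C :=
  (CI (P c) a (a + h) + CI (Q (a + h)) c (c + h)
   - CI (P (c + h)) a (a + h) - CI (Q a) c (c + h))%C.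

Let FPs s t : 0 <= s <= 1 -> 0 <= t <= 1 -> ccont (fun s => F (Phi s t)) s.
Proof.
intros H1 H2; apply (ccont_cdiff F (fun s => Phi s t)); [auto|].
eapply cderiv_ccont, Hs.
Qed.

Let FPt s t : 0 <= s <= 1 -> 0 <= t <= 1 -> ccont (fun t => F (Phi s t)) t.
Proof.
intros H1 H2; apply (ccont_cdiff F (fun t => Phi s t)); [auto|].
eapply cderiv_ccont, Ht.
Qed.

Let CP s t : 0 <= s <= 1 -> 0 <= t <= 1 -> ccont (P t) s.
Proof. intros H1 H2; apply ccont_mult; auto. Qed.

Let CQ s t : 0 <= s <= 1 -> 0 <= t <= 1 -> ccont (Q s) t.
Proof. intros H1 H2; apply ccont_mult; auto. Qed.

Let lip_s s s' t : 0 <= s -> s <= s' -> s' <= 1 -> 0 <= t <= 1 ->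
  Cmod (Phi s' t - Phi s t) <= (s' - s) * M.
Proof.
intros; apply (is_CI_bound (fun s => Ps s t) s s'); auto.
- intros; apply Bs; lra.
- apply (is_CI_cderiv (fun s => Phi s t)); auto.
Qed.

Let lip_t s t t' : 0 <= t -> t <= t' -> t' <= 1 -> 0 <= s <= 1 ->
  Cmod (Phi s t' - Phi s t) <= (t' - t) * M.
Proof.
intros; apply (is_CI_bound (fun t => Pt s t) t t'); auto.
- intros; apply Bt; lra.
- apply (is_CI_cderiv (fun t => Phi s t)); auto.
Qed.

Let lip s s' t t' h : 0 <= s <= 1 -> 0 <= s' <= 1 -> 0 <= t <= 1 -> 0 <= t' <= 1 ->
  Rabs (s' - s) <= h -> Rabs (t' - t) <= h ->
  Cmod (Phi s' t' - Phi s t) <= 2 * h * M.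
Proof.
intros I1 I2 I3 I4 A1 A2.
replace (Phi s' t' - Phi s t)%C with
  ((Phi s' t' - Phi s t') + (Phi s t' - Phi s t))%C by ring.
eapply Rle_trans; [apply Cmod_triangle|].
assert (Cmod (Phi s' t' - Phi s t') <= h * M).
{ destruct (Rle_dec s s') as [L|L].
  - rewrite Rabs_pos_eq in A1 by lra.
    eapply Rle_trans; [apply lip_s; lra | apply Rmult_le_compat_r; lra].
  - rewrite Rabs_left1 in A1 by lra; rewrite Cmod_minus_sym.
    eapply Rle_trans; [apply lip_s; lra | apply Rmult_le_compat_r; lra]. }
assert (Cmod (Phi s t' - Phi s t) <= h * M).
{ destruct (Rle_dec t t') as [L|L].
  - rewrite Rabs_pos_eq in A2 by lra.
    eapply Rle_trans; [apply lip_t; lra | apply Rmult_le_compat_r; lra].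
  - rewrite Rabs_left1 in A2 by lra; rewrite Cmod_minus_sym.
    eapply Rle_trans; [apply lip_t; lra | apply Rmult_le_compat_r; lra]. }
lra.
Qed.

(** Inner edges cancel, which gives additivity under quartering. Near a point, [F] is affine up to a
    small multiple of the distance, and the affine part integrates to zero around the closed image
    of the boundary. *)
Theorem goursat : square_integral 0 0 1 = 0%C.
Proof.
apply bisection_zero.
- intros a c h (Ha & Hc & Hh & Ha1 & Hc1); unfold square_integral.
  replace (a + h / 2 + h / 2) with (a + h) by field.
  replace (c + h / 2 + h / 2) with (c + h) by field.
  rewrite (CI_Chasles (P c) a (a + h / 2) (a + h)), (CI_Chasles (P (c + h)) a (a + h / 2) (a + h)),
    (CI_Chasles (Q a) c (c + h / 2) (c + h)), (CI_Chasles (Q (a + h)) c (c + h / 2) (c + h))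
    by (try lra; intros; first [apply CP | apply CQ]; lra).
  ring.
- intros s t Is It eps He.
  destruct (cdiff_expand F _ (HF s t Is It)) as (B & HB).
  set (A := (F (Phi s t) - B * Phi s t)%C).
  (* Each of the four edges contributes at most [h * (e * (2 * h * M) * M)], in total
     [8 * e * M^2 * h^2]. *)
  set (e := eps / (8 * M * M)).
  assert (HMM : 0 < 8 * M * M) by nra.
  assert (He' : 0 < e) by now apply Rdiv_lt_0_compat.
  destruct (HB e He') as (dl & Hdl & HE).
  (* A square of side [h] has an image within distance [2 * h * M] of [Phi s t]. *)
  exists (dl / (2 * M)); split; [apply Rdiv_lt_0_compat; lra|].
  intros a c h (Ha & Hc & Hh & Ha1 & Hc1) Hhd Hsa Htc.
  assert (HK : forall s' t', a <= s' <= a + h -> c <= t' <= c + h ->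
    Cmod (F (Phi s' t') - (A + B * Phi s' t')) <= e * (2 * h * M)).
  { intros s' t' Hs' Ht'.
    assert (L : Cmod (Phi s' t' - Phi s t) <= 2 * h * M)
      by (apply lip; try lra; apply Rabs_le; lra).
    replace (F (Phi s' t') - (A + B * Phi s' t'))%C with
      (F (Phi s' t') - F (Phi s t) - B * (Phi s' t' - Phi s t))%C by (unfold A; ring).
    eapply Rle_trans; [apply HE | apply Rmult_le_compat_l; lra].
    assert (h * (2 * M) < dl / (2 * M) * (2 * M)) by (apply Rmult_lt_compat_r; lra).
    replace (dl / (2 * M) * (2 * M)) with dl in H by (field; lra); lra. }
  set (K := e * (2 * h * M)) in HK.
  set (G := fun z => (A * z + B / 2 * (z * z))%C).
  assert (E1 : Cmod (CI (P c) a (a + h) - (G (Phi (a + h) c) - G (Phi a c))) <= h * (K * M)).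
  { replace h with (a + h - a) at 3 by ring;
    apply (edge_bound F (fun s => Phi s c) (fun s => Ps s c));
      auto; try lra; intros; [apply FPs; lra|apply HK; lra|apply Bs; lra]. }
  assert (E2 : Cmod (CI (P (c + h)) a (a + h) - (G (Phi (a + h) (c + h)) - G (Phi a (c + h))))
    <= h * (K * M)).
  { replace h with (a + h - a) at 6 by ring;
    apply (edge_bound F (fun s => Phi s (c + h)) (fun s => Ps s (c + h)));
      auto; try lra; intros; [apply FPs; lra|apply HK; lra|apply Bs; lra]. }
  assert (E3 : Cmod (CI (Q a) c (c + h) - (G (Phi a (c + h)) - G (Phi a c))) <= h * (K * M)).
  { replace h with (c + h - c) at 3 by ring;
    apply (edge_bound F (fun t => Phi a t) (fun t => Pt a t));
      auto; try lra; intros; [apply FPt; lra|apply HK; lra|apply Bt; lra]. }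
  assert (E4 : Cmod (CI (Q (a + h)) c (c + h) - (G (Phi (a + h) (c + h)) - G (Phi (a + h) c)))
    <= h * (K * M)).
  { replace h with (c + h - c) at 6 by ring;
    apply (edge_bound F (fun t => Phi (a + h) t) (fun t => Pt (a + h) t));
      auto; try lra; intros; [apply FPt; lra|apply HK; lra|apply Bt; lra]. }
  unfold square_integral.
  set (X1 := (CI (P c) a (a + h) - _)%C) in E1.
  set (X2 := (CI (P (c + h)) a (a + h) - _)%C) in E2.
  set (X3 := (CI (Q a) c (c + h) - _)%C) in E3.
  set (X4 := (CI (Q (a + h)) c (c + h) - _)%C) in E4.
  (* The values of [G] at the four corners cancel around the boundary, leaving the four edge
     errors. *)
  replace (CI (P c) a (a + h) + CI (Q (a + h)) c (c + h) - CI (P (c + h)) a (a + h)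
    - CI (Q a) c (c + h))%C with ((X1 + X4) - (X2 + X3))%C
    by (unfold X1, X2, X3, X4; ring).
  pose proof (Cmod_triangle_minus (X1 + X4) (X2 + X3)).
  pose proof (Cmod_triangle X1 X4); pose proof (Cmod_triangle X2 X3).
  replace (eps * (h * h)) with (4 * (h * (K * M))); [lra|].
  unfold K, e; field; lra.
Qed.
End Goursat.

(** * Cauchy's formula *)

Definition circ (t : R) : C := (cos (2 * PI * t), sin (2 * PI * t)).

Definition two_pi_i : C := (0, 2 * PI).

Lemma cderiv_circ (t : R) : cderiv circ t (two_pi_i * circ t)%C.
Proof. split; cbn; auto_derive; auto; ring. Qed.

Lemma Cmod_circ (t : R) : Cmod (circ t) = 1.
Proof.
unfold Cmod, circ; cbn [fst snd].
rewrite <- sqrt_1; f_equal; pose proof (sin2_cos2 (2 * PI * t)) as H; unfold Rsqr in H; lra.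
Qed.

Lemma circ_0 : circ 0 = RtoC 1.
Proof. unfold circ; now rewrite Rmult_0_r, cos_0, sin_0. Qed.

Lemma circ_1 : circ 1 = RtoC 1.
Proof. unfold circ; now rewrite Rmult_1_r, cos_2PI, sin_2PI. Qed.

Lemma ccont_circ (t : R) : ccont circ t.
Proof. eapply cderiv_ccont, cderiv_circ. Qed.

Lemma Cmod_two_pi_i : Cmod two_pi_i = 2 * PI.
Proof.
unfold two_pi_i, Cmod; cbn [fst snd]; pose proof PI_RGT_0.
replace (0 ^ 2 + (2 * PI) ^ 2) with ((2 * PI) ^ 2) by ring; apply sqrt_pow2; lra.
Qed.

Lemma two_pi_i_neq_0 : two_pi_i <> 0%C.
Proof. apply Cmod_gt_0; rewrite Cmod_two_pi_i; pose proof PI_RGT_0; lra. Qed.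

Lemma Cmod_RtoC (x : R) : 0 <= x -> Cmod x = x.
Proof. intros; rewrite Cmod_R; now apply Rabs_pos_eq. Qed.

Lemma cdiff_kernel (f : C -> C) (w z : C) : z <> w -> cdiff f z ->
  cdiff (fun z => f z * / (z - w))%C z.
Proof.
intros Hz Hf; apply cdiff2_mult; [exact Hf|].
apply (cdiff2_inv (fun p => fst p - w)%C).
- cbn; now apply Cminus_eq_contra.
- apply (cdiff2_ext (fun p => 1 * fst p + 0 * snd p + (- w))%C);
    [intros; ring | apply cdiff2_affine].
Qed.

(* The circle |z| = r is shrunk through the circles of centre s w and radius
   (1 - s) r + s rho, on which z - w does not vanish. *)
Lemma cauchy_shrink (f : C -> C) (r rho : R) (w : C) : 0 < rho -> rho + Cmod w < r ->
  (forall z, Cmod z <= r -> cdiff f z) ->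
  CI (fun t => f (r * circ t) * (r * circ t * / (r * circ t - w)))%C 0 1
  = CI (fun t => f (w + rho * circ t))%C 0 1.
Proof.
intros Hrho Hw Hf.
pose proof (Cmod_ge_0 w) as W0; pose proof PI_RGT_0 as HPI.
set (F := fun z => (f z * / (z - w))%C).
set (Rad := fun s : R => (1 - s) * r + s * rho).
set (Phi := fun s t : R => (s * w + Rad s * circ t)%C).
set (Ps := fun s t : R => (w + (rho - r)%R * circ t)%C).
set (Pt := fun s t : R => (Rad s * (two_pi_i * circ t))%C).
assert (dR : forall s, cderiv (fun s => RtoC (Rad s)) s (RtoC (rho - r)%R)).
{ intros s; split; cbn; unfold Rad; auto_derive; auto; ring. }
assert (dI : forall s, cderiv (fun s => RtoC s) s (RtoC 1)).
{ intros s; split; cbn; auto_derive; auto. }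
assert (Rad_pos : forall s, 0 <= s <= 1 -> 0 < Rad s <= r) by (unfold Rad; split; nra).
assert (G : square_integral F Phi Ps Pt 0 0 1 = 0%C).
(* The speed in [s] is at most [Cmod w + (r - rho)], hence at most [2 * r]; the speed in [t] is
   [2 * PI * Rad s], at most [2 * PI * r]. *)
{ apply goursat with (M := 2 * r + 2 * PI * r).
  - nra.
  - intros s t; unfold Phi, Ps.
    replace (w + (rho - r)%R * circ t)%C with
      ((RtoC 1 * w + s * RtoC 0) + ((rho - r)%R * circ t + Rad s * RtoC 0))%C by ring.
    apply (cderiv_plus (fun s => s * w)%C (fun s => Rad s * circ t)%C).
    + apply (cderiv_mult RtoC (fun _ => w)); auto using cderiv_const.
    + apply (cderiv_mult (fun s => RtoC (Rad s)) (fun _ => circ t)); auto using cderiv_const.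
  - intros s t; unfold Phi, Pt.
    replace (Rad s * (two_pi_i * circ t))%C with
      (RtoC 0 + (RtoC 0 * circ t + Rad s * (two_pi_i * circ t)))%C by ring.
    apply (cderiv_plus (fun _ => s * w)%C (fun t => Rad s * circ t)%C);
      [apply cderiv_const|].
    apply (cderiv_mult (fun _ => RtoC (Rad s)) circ); auto using cderiv_const, cderiv_circ.
  - intros s t; exact (ccont_const (Ps 0 t) s).
  - intros s t; unfold Pt; auto using ccont_mult, ccont_const, ccont_circ.
  - intros s t Is It; unfold Ps.
    eapply Rle_trans; [apply Cmod_triangle|].
    rewrite Cmod_mult, Cmod_circ, Cmod_R, Rabs_left1 by lra; nra.
  - intros s t Is It; unfold Pt.
    rewrite !Cmod_mult, Cmod_circ, Cmod_two_pi_i, Cmod_RtoC by (specialize (Rad_pos s Is); lra).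
    specialize (Rad_pos s Is); nra.
  - intros s t Is It; specialize (Rad_pos s Is).
    apply cdiff_kernel.
    (* If a circle of the homotopy met [w], taking moduli would give [Rad s = (1 - s) * Cmod w],
       impossible because [Cmod w < r] and [0 < rho]. *)
    + intros E; assert (E' : (Rad s * circ t = (1 - s)%R * w)%C).
      { unfold Phi in E; rewrite RtoC_minus.
        replace ((1 - s) * w)%C with (w - s * w)%C by ring; rewrite <- E at 1; ring. }
      apply (f_equal Cmod) in E'.
      rewrite !Cmod_mult, Cmod_circ, !Cmod_RtoC in E' by lra.
      unfold Rad in *; nra.
    + apply Hf; unfold Phi; eapply Rle_trans; [apply Cmod_triangle|].
      rewrite !Cmod_mult, Cmod_circ, !Cmod_RtoC by lra; unfold Rad in *; nra. }
unfold square_integral in G; rewrite !Rplus_0_l in G.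
(* The circles are closed, so the edges [t = 0] and [t = 1] have the same image and cancel. *)
replace (CI (fun s => F (Phi s 1) * Ps s 1)%C 0 1) with
  (CI (fun s => F (Phi s 0) * Ps s 0)%C 0 1) in G
  by (unfold Phi, Ps; now rewrite circ_0, circ_1).
assert (C0 : forall t, (r * circ t - w)%C <> 0%C).
{ intros t E; assert (E' : (r * circ t)%C = w)
    by (replace (r * circ t)%C with ((r * circ t - w) + w)%C by ring; rewrite E; ring).
  apply (f_equal Cmod) in E'; rewrite Cmod_mult, Cmod_circ, Cmod_RtoC in E'; lra. }
assert (K0 : is_CI (fun t => F (Phi 0 t) * Pt 0 t)%C 0 1 (two_pi_i *
   CI (fun t => f (r * circ t) * (r * circ t * / (r * circ t - w)))%C 0 1)%C).
{ apply is_CI_ext with (f := (fun t => two_pi_i *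
    (f (r * circ t) * (r * circ t * / (r * circ t - w))))%C); [lra| |].
  - intros t It; unfold F, Phi, Pt.
    replace (Rad 0) with r by (unfold Rad; ring).
    replace (0 * w + r * circ t)%C with (r * circ t)%C by ring; ring.
  - apply is_CI_scal, CI_correct; [lra|]; intros t It.
    assert (ccont (fun t => r * circ t)%C t) by auto using ccont_mult, ccont_const, ccont_circ.
    apply ccont_mult; [apply ccont_cdiff; auto; apply Hf;
      rewrite Cmod_mult, Cmod_circ, Cmod_RtoC; lra|].
    apply ccont_mult; auto; apply ccont_inv; auto using ccont_minus, ccont_const. }
(* On the circle centred at [w] the factor [z - w] equals [rho * circ t] and cancels against the
   velocity, leaving a mean value of [f]. *)
assert (K1 : is_CI (fun t => F (Phi 1 t) * Pt 1 t)%C 0 1 (two_pi_i *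
   CI (fun t => f (w + rho * circ t))%C 0 1)%C).
{ apply is_CI_ext with (f := (fun t => two_pi_i * f (w + rho * circ t))%C); [lra| |].
  - intros t It; unfold F, Phi, Pt.
    replace (Rad 1) with rho by (unfold Rad; ring).
    replace (1 * w + rho * circ t)%C with (w + rho * circ t)%C by ring.
    assert (circ t <> 0%C) by (apply Cmod_gt_0; rewrite Cmod_circ; lra).
    assert (RtoC rho <> 0%C) by (intros E; apply (f_equal fst) in E; cbn in E; lra).
    replace (w + rho * circ t - w)%C with (rho * circ t)%C by ring; field; auto.
  - apply is_CI_scal, CI_correct; [lra|]; intros t It.
    apply (ccont_cdiff f (fun t => w + rho * circ t)%C);
      [|auto using ccont_plus, ccont_mult, ccont_const, ccont_circ].
    apply Hf; eapply Rle_trans; [apply Cmod_triangle|].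
    rewrite Cmod_mult, Cmod_circ, Cmod_RtoC; lra. }
apply is_CI_unique in K0, K1; rewrite K0, K1 in G.
assert (E : (two_pi_i * (CI (fun t => f (w + rho * circ t))%C 0 1 -
  CI (fun t => f (r * circ t) * (r * circ t * / (r * circ t - w)))%C 0 1) = 0)%C)
  by (rewrite <- G; ring).
apply Ceq_minus; rewrite <- Copp_minus_distr.
destruct (Ceq_dec (CI (fun t => f (w + rho * circ t))%C 0 1 -
  CI (fun t => f (r * circ t) * (r * circ t * / (r * circ t - w)))%C 0 1)%C 0%C) as [Z|Z].
- rewrite Z; ring.
- exfalso; apply (Cmult_neq_0 _ _ two_pi_i_neq_0 Z E).
Qed.

(** By [cauchy_shrink] the integral equals the mean of [f] over every small circle around [w], and
    the Lipschitz bound at [w] makes this mean as close to [f w] as desired. *)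
Theorem cauchy_formula (f : C -> C) (r : R) (w : C) : Cmod w < r ->
  (forall z, Cmod z <= r -> cdiff f z) ->
  CI (fun t => f (r * circ t) * (r * circ t * / (r * circ t - w)))%C 0 1 = f w.
Proof.
intros Hw Hf; pose proof (Cmod_ge_0 w).
set (J := CI _ 0 1).
destruct (Ceq_dec J (f w)) as [|N]; [assumption|exfalso].
assert (He : 0 < Cmod (J - f w)) by now apply Cmod_gt_0, Cminus_eq_contra.
set (e := Cmod (J - f w)) in *.
destruct (cdiff2_lipschitz _ _ (Hf w ltac:(lra))) as (K & d & HK & Hd & L); cbn [fst snd] in L.
(* The three bounds keep the small circle inside the large one, inside the Lipschitz neighbourhood,
   and [K * rho] at most [e / 2]. *)
set (rho := Rmin ((r - Cmod w) / 2) (Rmin (d / 2) (e / (2 * K)))).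
assert (He2 : 0 < e / (2 * K)) by (apply Rdiv_lt_0_compat; lra).
assert (Hrho : 0 < rho) by (repeat apply Rmin_glb_lt; lra).
pose proof (Rmin_l ((r - Cmod w) / 2) (Rmin (d / 2) (e / (2 * K)))).
pose proof (Rmin_r ((r - Cmod w) / 2) (Rmin (d / 2) (e / (2 * K)))).
pose proof (Rmin_l (d / 2) (e / (2 * K))); pose proof (Rmin_r (d / 2) (e / (2 * K))).
fold rho in H0, H1.
assert (EJ : J = CI (fun t => f (w + rho * circ t))%C 0 1)
  by (apply cauchy_shrink; auto; lra).
assert (B : e <= (1 - 0) * (e / 2)).
{ apply is_CI_bound with (f := (fun t => f (w + rho * circ t) - f w)%C); [lra| |].
  - intros t It.
    assert (D : Cmod (w + rho * circ t - w) = rho).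
    { replace (w + rho * circ t - w)%C with (rho * circ t)%C by ring.
      rewrite Cmod_mult, Cmod_circ, Cmod_RtoC; lra. }
    assert (E0 : Cmod (0 - 0) = 0) by (replace (0 - 0)%C with (RtoC 0) by ring; apply Cmod_0).
    specialize (L (w + rho * circ t)%C 0%C); rewrite D, E0 in L.
    eapply Rle_trans; [apply L; lra|].
    replace (e / 2) with (K * (e / (2 * K))) by (field; lra).
    apply Rmult_le_compat_l; lra.
  - rewrite EJ.
    replace (f w) with ((1 - 0)%R * f w)%C at 1 by (rewrite RtoC_minus; ring).
    apply is_CI_minus; [|apply is_CI_const].
    apply CI_correct; [lra|]; intros t It.
    apply (ccont_cdiff f (fun t => w + rho * circ t)%C);
      [|auto using ccont_plus, ccont_mult, ccont_const, ccont_circ].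
    apply Hf; eapply Rle_trans; [apply Cmod_triangle|].
    rewrite Cmod_mult, Cmod_circ, Cmod_RtoC; lra. }
lra.
Qed.

(** * Holomorphic dependence of integrals on parameters *)

Lemma Cmod_minus_gt (Z X : C) (rho : R) : Cmod Z = rho -> Cmod X < rho / 2 ->
  rho / 2 < Cmod (Z - X).
Proof. intros HZ HX; pose proof (Cmod_le_minus Z X); lra. Qed.

Lemma kernel_nonzero (Z X : C) (rho : R) : 0 < rho -> Cmod Z = rho -> Cmod X < rho / 2 ->
  (Z - X)%C <> 0%C.
Proof.
intros H0 HZ HX; apply Cmod_gt_0; pose proof (Cmod_minus_gt Z X rho HZ HX); lra.
Qed.

Lemma kernel_bound (Z X : C) (rho : R) : 0 < rho -> Cmod Z = rho -> Cmod X < rho / 2 ->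
  Cmod (/ (Z - X)) <= 2 / rho.
Proof.
intros H0 HZ HX; pose proof (Cmod_minus_gt Z X rho HZ HX).
rewrite Cmod_inv by now apply (kernel_nonzero Z X rho).
replace (2 / rho) with (/ (rho / 2)) by (field; lra).
apply Rinv_le_contravar; lra.
Qed.

Lemma kernel_lipschitz (Z X Y : C) (rho : R) : 0 < rho -> Cmod Z = rho ->
  Cmod X < rho / 2 -> Cmod Y < rho / 2 ->
  Cmod (/ (Z - X) - / (Z - Y)) <= 2 / rho * (2 / rho) * Cmod (X - Y).
Proof.
intros H0 HZ HX HY.
pose proof (kernel_nonzero Z X rho H0 HZ HX); pose proof (kernel_nonzero Z Y rho H0 HZ HY).
replace (/ (Z - X) - / (Z - Y))%C with (/ (Z - X) * / (Z - Y) * (X - Y))%C by (field; auto).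
rewrite !Cmod_mult; apply Rmult_le_compat_r; [apply Cmod_ge_0|].
apply Rmult_le_compat; auto using Cmod_ge_0, kernel_bound.
Qed.

(** The remainder is exactly [(X - Y)^2 / ((Z - X) (Z - Y)^2)], and each of the three inverse
    factors is at most [2 / rho]. *)
Lemma kernel_expansion (Z X Y : C) (rho : R) : 0 < rho -> Cmod Z = rho ->
  Cmod X < rho / 2 -> Cmod Y < rho / 2 ->
  Cmod (/ (Z - X) - / (Z - Y) - / (Z - Y) * / (Z - Y) * (X - Y))
    <= 2 / rho * (2 / rho) * (2 / rho) * (Cmod (X - Y) * Cmod (X - Y)).
Proof.
intros H0 HZ HX HY.
pose proof (kernel_nonzero Z X rho H0 HZ HX); pose proof (kernel_nonzero Z Y rho H0 HZ HY).
replace (/ (Z - X) - / (Z - Y) - / (Z - Y) * / (Z - Y) * (X - Y))%C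
  with (/ (Z - X) * / (Z - Y) * / (Z - Y) * ((X - Y) * (X - Y)))%C by (field; auto).
pose proof (kernel_bound Z X rho H0 HZ HX); pose proof (kernel_bound Z Y rho H0 HZ HY).
rewrite !Cmod_mult; apply Rmult_le_compat_r; [apply Rmult_le_pos; apply Cmod_ge_0|].
repeat apply Rmult_le_compat; auto using Cmod_ge_0; apply Rmult_le_pos; apply Cmod_ge_0.
Qed.

Lemma Cmod_circle (r t : R) : 0 < r -> Cmod (r * circ t) = r.
Proof. intros; rewrite Cmod_mult, Cmod_circ, Cmod_RtoC; lra. Qed.

Lemma ccont_circle (r t : R) : ccont (fun t => r * circ t)%C t.
Proof. auto using ccont_mult, ccont_const, ccont_circ. Qed.

(** Cauchy's integral for the derivative of [g] at [y0]: on the circle [dz] is [2 pi i z dt], which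
    accounts for the factor [r * circ t]. *)
Definition cauchy_deriv (g : C -> C) (r : R) (y0 : C) : C :=
  CI (fun t => g (r * circ t) * (r * circ t) *
        (/ (r * circ t - y0) * / (r * circ t - y0)))%C 0 1.

Section OneVariable.
Variables (g : C -> C) (r M : R).
Hypothesis Hr : 0 < r.
Hypothesis Hg : forall z, Cmod z <= r -> cdiff g z.
Hypothesis HM : forall z, Cmod z <= r -> Cmod (g z) <= M.

Let ccont_g t : ccont (fun t => g (r * circ t) * (r * circ t))%C t.
Proof.
apply ccont_mult; [|apply ccont_circle].
apply ccont_cdiff; [|apply ccont_circle].
apply Hg; rewrite Cmod_circle; lra.
Qed.

Let ccont_k y t : Cmod y < r / 2 -> ccont (fun t => / (r * circ t - y))%C t.
Proof.
intros Hy; apply ccont_inv; [|auto using ccont_minus, ccont_circle, ccont_const].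
apply (kernel_nonzero _ _ r); auto using Cmod_circle.
Qed.

Let cauchy y : Cmod y < r / 2 ->
  is_CI (fun t => g (r * circ t) * (r * circ t) * / (r * circ t - y))%C 0 1 (g y).
Proof.
intros Hy; rewrite <- (cauchy_formula g r y) by (auto; lra).
eapply is_CI_ext; [lra| |apply CI_correct; [lra|]].
- intros t _; cbv beta; ring.
- intros t _; cbv beta.
  apply (ccont_mult (fun t => g (r * circ t))%C (fun t => r * circ t * / (r * circ t - y))%C).
  + apply ccont_cdiff; [apply Hg; rewrite Cmod_circle; lra | apply ccont_circle].
  + auto using ccont_mult, ccont_circle.
Qed.

(** The constant depends on [g] only through [M] and [r], so it is uniform over the slices of a
    function of two variables. The same holds for the quadratic estimate [cauchy_expansion]. *)
Lemma cauchy_lipschitz (y y0 : C) : Cmod y < r / 2 -> Cmod y0 < r / 2 ->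
  Cmod (g y - g y0) <= M * r * (2 / r * (2 / r)) * Cmod (y - y0).
Proof.
intros Hy Hy0.
rewrite <- (Rmult_1_l (M * r * (2 / r * (2 / r)) * Cmod (y - y0))).
replace 1 with (1 - 0) at 1 by ring.
eapply is_CI_bound; [lra| |apply is_CI_minus; apply cauchy; eassumption].
intros t _; cbv beta.
replace (g (r * circ t) * (r * circ t) * / (r * circ t - y) -
  g (r * circ t) * (r * circ t) * / (r * circ t - y0))%C with
  (g (r * circ t) * (r * circ t) * (/ (r * circ t - y) - / (r * circ t - y0)))%C by ring.
rewrite 2!Cmod_mult, Cmod_circle, !Rmult_assoc by auto.
pose proof (Cmod_ge_0 (g (r * circ t))).
apply Rmult_le_compat; auto; [apply Rmult_le_pos; [lra | apply Cmod_ge_0]| |].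
- apply HM; rewrite Cmod_circle; lra.
- apply Rmult_le_compat_l; [lra|].
  rewrite <- Rmult_assoc; apply kernel_lipschitz; auto using Cmod_circle.
Qed.

Lemma cauchy_expansion (y y0 : C) : Cmod y < r / 2 -> Cmod y0 < r / 2 ->
  Cmod (g y - g y0 - cauchy_deriv g r y0 * (y - y0))
    <= M * r * (2 / r * (2 / r) * (2 / r)) * (Cmod (y - y0) * Cmod (y - y0)).
Proof.
intros Hy Hy0.
set (N := Cmod (y - y0)).
rewrite <- (Rmult_1_l (M * r * (2 / r * (2 / r) * (2 / r)) * (N * N))).
replace 1 with (1 - 0) at 1 by ring.
rewrite (Cmult_comm (cauchy_deriv g r y0)).
eapply is_CI_bound; [lra| |apply is_CI_minus; [apply is_CI_minus; apply cauchy; eassumption|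
  apply is_CI_scal, CI_correct; [lra|intros t _; auto using ccont_mult]]].
intros t _; cbv beta.
match goal with |- Cmod ?w <= _ => replace w with
  (g (r * circ t) * (r * circ t) * (/ (r * circ t - y) - / (r * circ t - y0)
     - / (r * circ t - y0) * / (r * circ t - y0) * (y - y0)))%C by ring end.
rewrite 2!Cmod_mult, Cmod_circle by auto.
replace (M * r * (2 / r * (2 / r) * (2 / r)) * (N * N)) with
  (M * (r * (2 / r * (2 / r) * (2 / r) * (N * N)))) by ring.
rewrite (Rmult_assoc _ r).
pose proof (Cmod_ge_0 (g (r * circ t))).
apply Rmult_le_compat; auto; [apply Rmult_le_pos; [lra | apply Cmod_ge_0]| |].
- apply HM; rewrite Cmod_circle; lra.
- apply Rmult_le_compat_l; [lra|].
  apply kernel_expansion; auto using Cmod_circle.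
Qed.
End OneVariable.

(** Meant for difference quotients [q h] of a function with parameter [t]: a uniform rate of
    convergence makes the partial derivative [D] continuous in [t], hence integrable, which
    pointwise differentiability alone does not give. *)
Lemma ccont_uniform_limit (q : R -> R -> C) (D : R -> C) (dl K : R) : 0 < dl -> 0 <= K ->
  (forall h t, 0 < h < dl -> ccont (q h) t) ->
  (forall h t, 0 < h < dl -> Cmod (q h t - D t) <= K * h) ->
  forall t, ccont D t.
Proof.
intros Hdl HK Hq HD t e He.
set (h := Rmin (dl / 2) (e / (3 * (K + 1)))).
assert (He3 : 0 < e / (3 * (K + 1))) by (apply Rdiv_lt_0_compat; lra).
pose proof (Rmin_l (dl / 2) (e / (3 * (K + 1)))).
pose proof (Rmin_r (dl / 2) (e / (3 * (K + 1)))); fold h in H, H0.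
assert (Hh : 0 < h) by (apply Rmin_glb_lt; lra).
assert (Kh : K * h <= e / 3).
{ replace (e / 3) with ((K + 1) * (e / (3 * (K + 1)))) by (field; lra).
  apply Rmult_le_compat; lra. }
destruct (Hq h t ltac:(lra) (e / 3) ltac:(lra)) as (d & Hd & H1).
exists d; split; auto; intros s Hs; specialize (H1 s Hs).
pose proof (HD h s ltac:(lra)) as Ds; pose proof (HD h t ltac:(lra)) as Dt.
replace (D s - D t)%C with (((q h s - q h t) - (q h s - D s)) + (q h t - D t))%C by ring.
eapply Rle_trans; [apply Cmod_triangle|].
eapply Rle_trans; [apply Rplus_le_compat_r, Cmod_triangle_minus|]; lra.
Qed.

(** Differentiation under the integral sign for an integrand whose two parameters sit in separate
    factors. The quadratic remainders are uniform in [t], so they survive integration. *)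
Lemma cdiff2_integral (u k : R -> C -> C) (du dk : R -> C) (X0 y0 : C) (dl K : R) :
  0 < dl ->
  (forall t X, Cmod (X - X0) < dl -> ccont (fun t => k t X) t) ->
  (forall t y, Cmod (y - y0) < dl -> ccont (fun t => u t y) t) ->
  (forall t, ccont dk t) -> (forall t, ccont du t) ->
  (forall t, Cmod (k t X0) <= K) -> (forall t, Cmod (u t y0) <= K) ->
  (forall t X, Cmod (X - X0) < dl -> Cmod (k t X - k t X0) <= K * Cmod (X - X0)) ->
  (forall t y, Cmod (y - y0) < dl -> Cmod (u t y - u t y0) <= K * Cmod (y - y0)) ->
  (forall t X, Cmod (X - X0) < dl ->
     Cmod (k t X - k t X0 - dk t * (X - X0)) <= K * (Cmod (X - X0) * Cmod (X - X0))) ->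
  (forall t y, Cmod (y - y0) < dl ->
     Cmod (u t y - u t y0 - du t * (y - y0)) <= K * (Cmod (y - y0) * Cmod (y - y0))) ->
  cdiff2 (fun p => CI (fun t => u t (snd p) * k t (fst p))%C 0 1) (X0, y0).
Proof.
intros Hdl Ck Cu Cdk Cdu Bk Bu Lk Lu Ek Eu.
assert (N0 : forall x : C, Cmod (x - x) < dl)
  by (intros x; replace (x - x)%C with (RtoC 0) by ring; now rewrite Cmod_0).
exists (CI (fun t => u t y0 * dk t)%C 0 1), (CI (fun t => du t * k t X0)%C 0 1).
intros eps Heps; cbn [fst snd].
assert (K0 : 0 <= K) by (eapply Rle_trans; [apply Cmod_ge_0 | apply (Bk 0)]).
(* A positive upper bound for [K * K]; the [+ 1] makes division possible when [K] is zero. *)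
set (K3 := 3 * (K * K) + 1).
assert (HK3 : 0 < K3) by (unfold K3; nra).
set (e' := eps / (2 * K3)).
assert (He' : 0 < e') by (apply Rdiv_lt_0_compat; lra).
exists (Rmin dl e'); split; [now apply Rmin_glb_lt|].
intros X y HX Hy.
pose proof (Rmin_l dl e'); pose proof (Rmin_r dl e').
pose proof (Cmod_ge_0 (X - X0)) as NX; pose proof (Cmod_ge_0 (y - y0)) as Ny.
set (nx := Cmod (X - X0)) in *; set (ny := Cmod (y - y0)) in *.
replace (eps * (nx + ny)) with ((1 - 0) * (2 * e' * K3 * (nx + ny)))
  by (unfold e'; field; lra).
rewrite (Cmult_comm _ (X - X0)), (Cmult_comm _ (y - y0)).
eapply is_CI_bound; [lra| |].
2: { apply is_CI_minus; [apply is_CI_minus; [apply is_CI_minus|apply is_CI_scal]|apply is_CI_scal];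
     (apply CI_correct; [lra|]); intros t _; apply ccont_mult; auto;
     first [apply Cu | apply Ck]; unfold nx, ny in *; lra. }
intros t _; cbv beta.
(* The product rule with its error: one remainder per factor and the product of the two increments,
   all of second order. *)
match goal with |- Cmod ?w <= _ => replace w with
  ((u t y - u t y0 - du t * (y - y0)) * k t X0
   + (u t y0 * (k t X - k t X0 - dk t * (X - X0))
      + (u t y - u t y0) * (k t X - k t X0)))%C by ring end.
specialize (Lk t X ltac:(unfold nx in *; lra)); specialize (Lu t y ltac:(unfold ny in *; lra)).
specialize (Ek t X ltac:(unfold nx in *; lra)); specialize (Eu t y ltac:(unfold ny in *; lra)).
specialize (Bk t); specialize (Bu t).
fold nx in Lk, Ek; fold ny in Lu, Eu.
eapply Rle_trans; [apply Cmod_triangle|].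
eapply Rle_trans; [apply Rplus_le_compat_l, Cmod_triangle|].
rewrite !Cmod_mult.
assert (T1 : Cmod (u t y - u t y0 - du t * (y - y0)) * Cmod (k t X0) <= K * (ny * ny) * K)
  by (apply Rmult_le_compat; auto using Cmod_ge_0).
assert (T2 : Cmod (u t y0) * Cmod (k t X - k t X0 - dk t * (X - X0)) <= K * (K * (nx * nx)))
  by (apply Rmult_le_compat; auto using Cmod_ge_0).
assert (T3 : Cmod (u t y - u t y0) * Cmod (k t X - k t X0) <= (K * ny) * (K * nx))
  by (apply Rmult_le_compat; auto using Cmod_ge_0).
apply Rle_trans with (K * K * (ny * ny + nx * nx + ny * nx)); [nra|].
apply Rle_trans with (K * K * (2 * e' * (nx + ny))).
- apply Rmult_le_compat_l; nra.
- assert (0 <= 2 * e' * (nx + ny)) by (apply Rmult_le_pos; lra).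
  replace (2 * e' * K3 * (nx + ny)) with (K3 * (2 * e' * (nx + ny))) by ring.
  apply Rmult_le_compat_r; [auto|unfold K3; nra].
Qed.

(** * Splitting by residues of the exponent *)

Fixpoint csum (n : nat) (u : nat -> C) : C :=
  match n with O => RtoC 0 | S m => (csum m u + u m)%C end.

Lemma csum_ext (n : nat) (u v : nat -> C) :
  (forall i, (i < n)%nat -> u i = v i) -> csum n u = csum n v.
Proof.
induction n as [|n IH]; intros H; simpl; [reflexivity|].
rewrite IH, H by (intros; try apply H; lia); reflexivity.
Qed.

Lemma csum_scal (n : nat) (c : C) (u : nat -> C) :
  csum n (fun i => c * u i)%C = (c * csum n u)%C.
Proof. induction n as [|n IH]; simpl; [|rewrite IH]; ring. Qed.

Lemma csum_plus (n : nat) (u v : nat -> C) :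
  csum n (fun i => u i + v i)%C = (csum n u + csum n v)%C.
Proof. induction n as [|n IH]; simpl; [|rewrite IH]; ring. Qed.

Lemma csum_const (n : nat) (c : C) : csum n (fun _ => c) = (INR n * c)%C.
Proof.
induction n as [|n IH]; cbn [csum]; [cbn; ring|].
rewrite IH, S_INR, RtoC_plus; ring.
Qed.

(** The finite expansion of the Cauchy kernel with denominators cleared. *)
Lemma geometric_kernel (n : nat) (z x : C) :
  ((z - x) * csum n (fun a => x ^ a * z ^ (n - a)) = z * (z ^ n - x ^ n))%C.
Proof.
induction n as [|n IH]; cbn [csum].
- change ((z - x) * 0 = z * (1 - 1))%C; ring.
- replace (S n - n)%nat with 1%nat by lia; rewrite Cpow_1_r.
  rewrite (csum_ext n _ (fun a => z * (x ^ a * z ^ (n - a)))%C).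
  + rewrite csum_scal, !Cpow_S, Cmult_plus_distr_l.
    replace ((z - x) * (z * csum n (fun a => x ^ a * z ^ (n - a))))%C with
      (z * ((z - x) * csum n (fun a => x ^ a * z ^ (n - a))))%C by ring.
    rewrite IH; ring.
  + intros a Ha; replace (S n - a)%nat with (S (n - a)) by lia; rewrite Cpow_S; ring.
Qed.

Lemma is_CI_csum (n : nat) (f : nat -> R -> C) (a b : R) (l : nat -> C) :
  (forall i, (i < n)%nat -> is_CI (f i) a b (l i)) ->
  is_CI (fun t => csum n (fun i => f i t)) a b (csum n l).
Proof.
induction n as [|n IH]; intros H; simpl.
- pose proof (is_CI_const a b 0%C) as H0; now rewrite Cmult_0_r in H0.
- apply is_CI_plus; [apply IH; intros; apply H; lia | apply H; lia].
Qed.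

Lemma cdiff_snd_slice (f : C * C -> C) (x y : C) :
  cdiff2 f (x, y) -> cdiff (fun y => f (x, y)) y.
Proof.
intros H; apply (cdiff2_comp f (fun _ => x) fst); auto using cdiff2_const, cdiff2_fst.
Qed.

Lemma cdiff_fst_slice (f : C * C -> C) (x y : C) :
  cdiff2 f (x, y) -> cdiff (fun x => f (x, y)) x.
Proof.
intros H; apply (cdiff2_comp f fst (fun _ => y)); auto using cdiff2_const, cdiff2_fst.
Qed.

Section CauchySplit.
Variables (f : C * C -> C) (r M : R) (d : nat).
Hypothesis Hr : 0 < r.
Hypothesis Hf : forall x y, Cmod x <= r -> Cmod y <= r -> cdiff2 f (x, y).
Hypothesis HM : forall x y, Cmod x <= r -> Cmod y <= r -> Cmod (f (x, y)) <= M.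

(** The coefficient of [x^a], with a free variable [fst p] in place of [x^d]: this makes it a
    function on a full neighbourhood of the origin, holomorphic in both variables. *)
Definition split_part (a : nat) (p : C * C) : C :=
  CI (fun t => f (r * circ t, snd p)
        * ((r * circ t) ^ (d - a) * / ((r * circ t) ^ d - fst p)))%C 0 1.

Let Hcirc t : Cmod (r * circ t) <= r.
Proof. rewrite Cmod_circle; lra. Qed.

Let Hpow t n : Cmod ((r * circ t) ^ n)%C = r ^ n.
Proof. now rewrite Cmod_pow, Cmod_circle. Qed.

Let ccont_u t y : Cmod y <= r -> ccont (fun t => f (r * circ t, y)%C) t.
Proof.
intros Hy; apply (ccont_comp f (fun t => r * circ t)%C (fun _ => y) t);
  auto using ccont_circle, ccont_const.
Qed.

Let ccont_k t a X : (forall t, (r * circ t) ^ d - X <> 0)%C ->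
  ccont (fun t => (r * circ t) ^ (d - a) * / ((r * circ t) ^ d - X))%C t.
Proof.
intros HX; apply ccont_mult; [apply ccont_pow, ccont_circle|].
apply ccont_inv; [apply HX|].
apply ccont_minus; [apply ccont_pow, ccont_circle | apply ccont_const].
Qed.

(** In [X] only the kernel varies, on the circle of radius [rho = r^d]; in [y] only [f] varies, and
    Cauchy's formula on its slices gives estimates with constants independent of [t]. Halving both
    radii keeps the kernels bounded. *)
Lemma split_part_holo (a : nat) : holomorphic_germ (split_part a).
Proof.
set (rho := r ^ d); assert (Hrho : 0 < rho) by now apply pow_lt.
apply holomorphic_germ_iff; exists (Rmin (r / 2) (rho / 2)); split.
{ apply Rmin_glb_lt; lra. }
intros X0 y0 HX0 Hy0.
pose proof (Rmin_l (r / 2) (rho / 2)); pose proof (Rmin_r (r / 2) (rho / 2)).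
set (dl := Rmin (r / 2 - Cmod y0) (rho / 2 - Cmod X0)).
assert (Hdl : 0 < dl) by (apply Rmin_glb_lt; lra).
assert (NX : forall X, Cmod (X - X0) < dl -> Cmod X < rho / 2).
{ intros X HX; pose proof (Rmin_r (r / 2 - Cmod y0) (rho / 2 - Cmod X0)).
  pose proof (Cmod_le_minus X X0); fold dl in H1; lra. }
assert (Ny : forall y, Cmod (y - y0) < dl -> Cmod y < r / 2).
{ intros y Hy; pose proof (Rmin_l (r / 2 - Cmod y0) (rho / 2 - Cmod X0)).
  pose proof (Cmod_le_minus y y0); fold dl in H1; lra. }
assert (Kne : forall X, Cmod X < rho / 2 -> forall t, ((r * circ t) ^ d - X <> 0)%C).
{ intros X HX t; apply (kernel_nonzero _ _ rho); auto; apply Hpow. }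
assert (M0 : 0 <= M).
{ eapply Rle_trans; [apply Cmod_ge_0|]; apply (HM 0%C 0%C); rewrite Cmod_0; lra. }
assert (P0 : 0 < r ^ (d - a)) by now apply pow_lt.
assert (Q0 : 0 < 2 / r) by (apply Rdiv_lt_0_compat; lra).
assert (Q1 : 0 < 2 / rho) by (apply Rdiv_lt_0_compat; lra).
(* [K1], [K2], [K3] bound the kernel, its increments and its quadratic remainder; [K4], [K5] bound
   the increments and the remainder of the slices of [f]. Their sum with [M] serves as the single
   constant. *)
set (K1 := r ^ (d - a) * (2 / rho)).
set (K2 := r ^ (d - a) * (2 / rho * (2 / rho))).
set (K3 := r ^ (d - a) * (2 / rho * (2 / rho) * (2 / rho))).
set (K4 := M * r * (2 / r * (2 / r))).
set (K5 := M * r * (2 / r * (2 / r) * (2 / r))).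
assert (0 <= K1) by (unfold K1; repeat apply Rmult_le_pos; lra).
assert (0 <= K2) by (unfold K2; repeat apply Rmult_le_pos; lra).
assert (0 <= K3) by (unfold K3; repeat apply Rmult_le_pos; lra).
assert (0 <= K4) by (unfold K4; repeat apply Rmult_le_pos; lra).
assert (0 <= K5) by (unfold K5; repeat apply Rmult_le_pos; lra).
assert (Eu : forall t y, Cmod y < r / 2 ->
  Cmod (f (r * circ t, y)%C - f (r * circ t, y0)%C
        - cauchy_deriv (fun y => f (r * circ t, y)%C) r y0 * (y - y0))
  <= K5 * (Cmod (y - y0) * Cmod (y - y0))).
{ intros t y Hy; apply (cauchy_expansion (fun y => f (r * circ t, y)%C)); auto; try lra.
  intros z Hz; apply cdiff_snd_slice; auto. }
apply (cdiff2_integral (fun t y => f (r * circ t, y)%C)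
  (fun t X => (r * circ t) ^ (d - a) * / ((r * circ t) ^ d - X))%C
  (fun t => cauchy_deriv (fun y => f (r * circ t, y)%C) r y0)
  (fun t => (r * circ t) ^ (d - a) *
     (/ ((r * circ t) ^ d - X0) * / ((r * circ t) ^ d - X0)))%C
  X0 y0 dl (M + K1 + K2 + K3 + K4 + K5) Hdl).
- intros t X HX; apply ccont_k; auto.
- intros t y Hy; apply ccont_u; specialize (Ny y Hy); lra.
- intros t; apply ccont_mult; [apply ccont_pow, ccont_circle|].
  assert (ccont (fun t => / ((r * circ t) ^ d - X0))%C t).
  { apply ccont_inv; [apply Kne; lra|].
    apply ccont_minus; [apply ccont_pow, ccont_circle | apply ccont_const]. }
  now apply ccont_mult.
(* Continuity in [t] of the partial derivative of [f] in [y]: real difference quotients converge to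
   it at rate [K5 * h]. *)
- apply (ccont_uniform_limit (fun h t => / h *
    (f (r * circ t, y0 + h)%C - f (r * circ t, y0)%C))%C _ dl K5); auto.
  + intros h t Hh.
    assert (Cmod (y0 + h - y0) < dl) by (replace (y0 + h - y0)%C with (RtoC h) by ring;
      rewrite Cmod_RtoC; lra).
    apply ccont_mult; [apply ccont_const|].
    apply ccont_minus; apply ccont_u; [specialize (Ny (y0 + h)%C H6)|]; lra.
  + intros h t Hh.
    assert (Eh : (y0 + h - y0)%C = RtoC h) by ring.
    assert (Nh : Cmod (y0 + h - y0) < dl) by (rewrite Eh, Cmod_RtoC; lra).
    specialize (Eu t (y0 + h)%C (Ny _ Nh)); rewrite Eh, Cmod_RtoC in Eu by lra.
    assert (Hh0 : RtoC h <> 0%C) by (intros E; apply (f_equal fst) in E; cbn in E; lra).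
    replace (/ h * (f (r * circ t, y0 + h) - f (r * circ t, y0))
        - cauchy_deriv (fun y => f (r * circ t, y)) r y0)%C with
      (/ h * (f (r * circ t, y0 + h) - f (r * circ t, y0)
        - cauchy_deriv (fun y => f (r * circ t, y)) r y0 * h))%C by (field; auto).
    rewrite Cmod_mult, Cmod_inv, Cmod_RtoC by (auto; lra).
    replace (K5 * h) with (/ h * (K5 * (h * h))) by (field; lra).
    apply Rmult_le_compat_l; [left; apply Rinv_0_lt_compat; lra | exact Eu].
- intros t; rewrite Cmod_mult, Hpow.
  apply Rle_trans with K1; [|lra].
  apply Rmult_le_compat_l; [lra|]; apply kernel_bound; auto; try lra; apply Hpow.
- intros t; apply Rle_trans with M; [apply HM; auto; lra | lra].
- intros t X HX.
  replace ((r * circ t) ^ (d - a) * / ((r * circ t) ^ d - X) -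
     (r * circ t) ^ (d - a) * / ((r * circ t) ^ d - X0))%C with
     ((r * circ t) ^ (d - a) * (/ ((r * circ t) ^ d - X) - / ((r * circ t) ^ d - X0)))%C by ring.
  rewrite Cmod_mult, Hpow.
  apply Rle_trans with (K2 * Cmod (X - X0));
    [|apply Rmult_le_compat_r; [apply Cmod_ge_0 | lra]].
  unfold K2; rewrite Rmult_assoc; apply Rmult_le_compat_l; [lra|].
  apply kernel_lipschitz; auto; try lra; apply Hpow.
- intros t y Hy.
  apply Rle_trans with (K4 * Cmod (y - y0));
    [|apply Rmult_le_compat_r; [apply Cmod_ge_0 | lra]].
  apply (cauchy_lipschitz (fun y => f (r * circ t, y)%C) r M); auto; try lra.
  intros z Hz; apply cdiff_snd_slice; auto.
- intros t X HX.
  match goal with |- Cmod ?w <= _ => replace w with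
     ((r * circ t) ^ (d - a) * (/ ((r * circ t) ^ d - X) - / ((r * circ t) ^ d - X0)
       - / ((r * circ t) ^ d - X0) * / ((r * circ t) ^ d - X0) * (X - X0)))%C by ring end.
  rewrite Cmod_mult, Hpow.
  apply Rle_trans with (K3 * (Cmod (X - X0) * Cmod (X - X0)));
    [|apply Rmult_le_compat_r; [apply Rmult_le_pos; apply Cmod_ge_0 | lra]].
  unfold K3; rewrite (Rmult_assoc (r ^ (d - a))); apply Rmult_le_compat_l; [lra|].
  apply kernel_expansion; auto; try lra; apply Hpow.
- intros t y Hy.
  apply Rle_trans with (K5 * (Cmod (y - y0) * Cmod (y - y0)));
    [auto|apply Rmult_le_compat_r; [apply Rmult_le_pos; apply Cmod_ge_0 | lra]].
Qed.

Lemma split_part_sum (x y : C) : (0 < d)%nat -> Cmod x < r -> Cmod y <= r ->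
  f (x, y) = csum d (fun a => x ^ a * split_part a (x ^ d, y))%C.
Proof.
intros Hd Hx Hy.
assert (Kne : forall t, ((r * circ t) ^ d - x ^ d <> 0)%C).
{ intros t E.
  assert (E' : ((r * circ t) ^ d = x ^ d)%C)
    by (replace ((r * circ t) ^ d)%C with ((r * circ t) ^ d - x ^ d + x ^ d)%C by ring;
        rewrite E; ring).
  apply (f_equal Cmod) in E'; rewrite Hpow, Cmod_pow in E'.
  assert (Cmod x ^ d < r ^ d); [|lra].
  pose proof (Cmod_ge_0 x) as Hx0; clear - Hd Hx Hx0.
  destruct d as [|n]; [lia|]; clear Hd; induction n as [|n IH]; [simpl; lra|].
  change (Cmod x * Cmod x ^ S n < r * r ^ S n).
  apply Rmult_le_0_lt_compat; auto; apply pow_le; lra. }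
rewrite <- (cauchy_formula (fun x => f (x, y)) r x) by
  (auto; intros z Hz; apply cdiff_fst_slice; auto).
apply is_CI_unique.
eapply is_CI_ext; [lra| |apply (is_CI_csum d (fun a t => x ^ a * (f (r * circ t, y)
     * ((r * circ t) ^ (d - a) * / ((r * circ t) ^ d - x ^ d))))%C)].
- intros t _; cbv beta.
  assert (Z : (r * circ t - x <> 0)%C).
  { intros E; apply (f_equal Cmod) in E; pose proof (Cmod_le_minus (r * circ t) x).
    rewrite Cmod_0 in E; rewrite Cmod_circle in H; lra. }
  rewrite (csum_ext d _ (fun a => (f (r * circ t, y) * / ((r * circ t) ^ d - x ^ d))
    * (x ^ a * (r * circ t) ^ (d - a)))%C) by (intros; ring).
  rewrite csum_scal.
  pose proof (geometric_kernel d (r * circ t) x) as G.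
  set (S := csum d _) in *; set (z := (r * circ t)%C) in *.
  replace S with (z * (z ^ d - x ^ d) * / (z - x))%C by (rewrite <- G; field; auto).
  field; split; auto; apply Kne.
- intros a Ha; apply is_CI_scal, CI_correct; [lra|].
  intros t _; apply ccont_mult; auto.
Qed.
End CauchySplit.

(** The bound [M] comes from the Lipschitz estimate at the origin. *)
Lemma germ_bound (f : C * C -> C) : holomorphic_germ f -> exists r M, 0 < r /\
  (forall x y, Cmod x <= r -> Cmod y <= r -> cdiff2 f (x, y)) /\
  (forall x y, Cmod x <= r -> Cmod y <= r -> Cmod (f (x, y)) <= M).
Proof.
intros H; apply holomorphic_germ_iff in H; destruct H as (r0 & Hr0 & Hf).
assert (Z : Cmod 0 < r0) by now rewrite Cmod_0.
destruct (cdiff2_lipschitz f _ (Hf 0%C 0%C Z Z)) as (K & dl & HK & Hdl & L); cbn [fst snd] in L.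
pose proof (Rmin_l (r0 / 2) (dl / 2)); pose proof (Rmin_r (r0 / 2) (dl / 2)).
exists (Rmin (r0 / 2) (dl / 2)), (Cmod (f (RtoC 0, RtoC 0)) + K * (2 * dl)).
split; [apply Rmin_glb_lt; lra|].
split; intros x y Hx Hy; [apply Hf; lra|].
assert (Ex : (x - 0)%C = x) by ring; assert (Ey : (y - 0)%C = y) by ring.
specialize (L x y); rewrite Ex, Ey in L.
eapply Rle_trans; [apply (Cmod_le_minus _ (f (RtoC 0, RtoC 0)))|].
apply Rplus_le_compat_l; eapply Rle_trans; [apply L; lra|].
apply Rmult_le_compat_l; lra.
Qed.

Theorem split_fst (f : C * C -> C) (d : nat) : (0 < d)%nat -> holomorphic_germ f ->
  exists h : nat -> C * C -> C, (forall a, holomorphic_germ (h a)) /\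
    locally origin (fun z : C2 =>
      f z = csum d (fun a => fst z ^ a * h a (fst z ^ d, snd z))%C).
Proof.
intros Hd Hf; destruct (germ_bound f Hf) as (r & M & Hr & Hc & HM).
exists (split_part f r d); split.
- intros a; now apply split_part_holo with (M := M).
- apply locally_origin; exists r; split; auto; intros x y Hx Hy.
  apply split_part_sum; cbn [snd]; auto; lra.
Qed.

(** * Eigenmodules *)

Lemma locally_and (P Q : C * C -> Prop) :
  locally origin P -> locally origin Q -> locally origin (fun z => P z /\ Q z).
Proof. exact (@filter_and _ _ (@filter_filter _ _ (locally_filter (origin : C2))) P Q). Qed.

Lemma locally_imp (P Q : C * C -> Prop) :
  (forall z, P z -> Q z) -> locally origin P -> locally origin Q.
Proof.
intros H; exact (@filter_imp _ _ (@filter_filter _ _ (locally_filter (origin : C2))) P Q H).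
Qed.

Lemma locally_all (P : C * C -> Prop) : (forall z, P z) -> locally origin P.
Proof. intros H; apply locally_origin; exists 1; split; [lra|auto]. Qed.

Lemma locally_scale (P : C * C -> Prop) (u v : C) : locally origin P ->
  locally origin (fun z : C2 => P (u * fst z, v * snd z)%C).
Proof.
intros H; apply locally_origin in H; destruct H as (r & Hr & H); apply locally_origin.
pose proof (Cmod_ge_0 u); pose proof (Cmod_ge_0 v).
set (B := Cmod u + Cmod v + 1); assert (HB : 0 < B) by (unfold B; lra).
exists (r / B); split; [now apply Rdiv_lt_0_compat|]; intros x y Hx Hy; cbn [fst snd].
assert (E : B * (r / B) = r) by (field; lra).
apply H; rewrite Cmod_mult; rewrite <- E.
- apply Rle_lt_trans with (B * Cmod x); [|apply Rmult_lt_compat_l; lra].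
  apply Rmult_le_compat_r; [apply Cmod_ge_0 | unfold B; lra].
- apply Rle_lt_trans with (B * Cmod y); [|apply Rmult_lt_compat_l; lra].
  apply Rmult_le_compat_r; [apply Cmod_ge_0 | unfold B; lra].
Qed.

Lemma germ_eq_sym (f g : C * C -> C) : germ_eq f g -> germ_eq g f.
Proof. apply locally_imp; auto. Qed.

Lemma holo_germ_eq (f g : C * C -> C) :
  germ_eq f g -> holomorphic_germ f -> holomorphic_germ g.
Proof.
intros E H; apply locally_origin in E; destruct E as (r1 & Hr1 & E).
apply holomorphic_germ_iff in H; destruct H as (r2 & Hr2 & H).
apply holomorphic_germ_iff; exists (Rmin r1 r2); split; [now apply Rmin_glb_lt|].
pose proof (Rmin_l r1 r2); pose proof (Rmin_r r1 r2).
intros x y Hx Hy.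
apply cdiff2_ext_loc with (f := f) (r := Rmin (r1 - Cmod x) (r1 - Cmod y)).
- apply Rmin_glb_lt; lra.
- intros x' y' Hx' Hy'; cbn [fst snd] in *.
  pose proof (Rmin_l (r1 - Cmod x) (r1 - Cmod y)); pose proof (Rmin_r (r1 - Cmod x) (r1 - Cmod y)).
  pose proof (Cmod_le_minus x' x); pose proof (Cmod_le_minus y' y).
  apply E; lra.
- apply H; lra.
Qed.

Lemma holo_binary (op : (C * C -> C) -> (C * C -> C) -> C * C -> C) :
  (forall f g p, cdiff2 f p -> cdiff2 g p -> cdiff2 (op f g) p) ->
  forall f g, holomorphic_germ f -> holomorphic_germ g -> holomorphic_germ (op f g).
Proof.
intros Hop f g Hf Hg; apply holomorphic_germ_iff in Hf, Hg.
destruct Hf as (r1 & Hr1 & Hf); destruct Hg as (r2 & Hr2 & Hg).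
apply holomorphic_germ_iff; exists (Rmin r1 r2); split; [now apply Rmin_glb_lt|].
pose proof (Rmin_l r1 r2); pose proof (Rmin_r r1 r2).
intros x y Hx Hy; apply Hop; [apply Hf | apply Hg]; lra.
Qed.

Lemma holo_plus (f g : C * C -> C) : holomorphic_germ f -> holomorphic_germ g ->
  holomorphic_germ (fun z => f z + g z)%C.
Proof. exact (holo_binary (fun f g z => f z + g z)%C cdiff2_plus f g). Qed.

Lemma holo_mult (f g : C * C -> C) : holomorphic_germ f -> holomorphic_germ g ->
  holomorphic_germ (fun z => f z * g z)%C.
Proof. exact (holo_binary (fun f g z => f z * g z)%C cdiff2_mult f g). Qed.

Lemma holo_everywhere (f : C * C -> C) : (forall p, cdiff2 f p) -> holomorphic_germ f.
Proof.
intros H; apply holomorphic_germ_iff; exists 1; split; [lra|intros x y _ _; apply H].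
Qed.

Definition mono (a b : nat) (z : C * C) : C := (fst z ^ a * snd z ^ b)%C.

Lemma holo_mono (a b : nat) : holomorphic_germ (mono a b).
Proof.
apply holo_everywhere; intros p; apply cdiff2_mult; apply cdiff2_pow;
  [apply cdiff2_fst | apply cdiff2_snd].
Qed.

Lemma Cmod_pow_small (x : C) (n : nat) (r : R) : (0 < n)%nat -> Cmod x < 1 -> Cmod x < r ->
  Cmod (x ^ n) < r.
Proof.
intros Hn H1 Hr; rewrite Cmod_pow; apply Rle_lt_trans with (Cmod x); [|assumption].
destruct n as [|n]; [lia|]; pose proof (Cmod_ge_0 x).
assert (Cmod x ^ n <= 1) by (rewrite <- (pow1 n); apply pow_incr; lra).
simpl; assert (0 <= Cmod x ^ n) by now apply pow_le.
nra.
Qed.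

Lemma locally_pow (P : C * C -> Prop) (m n : nat) : (0 < m)%nat -> (0 < n)%nat ->
  locally origin P -> locally origin (fun z : C2 => P (fst z ^ m, snd z ^ n)%C).
Proof.
intros Hm Hn H; apply locally_origin in H; destruct H as (r & Hr & H).
apply locally_origin; exists (Rmin 1 r); split; [apply Rmin_glb_lt; lra|].
pose proof (Rmin_l 1 r); pose proof (Rmin_r 1 r).
intros x y Hx Hy; cbn [fst snd]; apply H; apply Cmod_pow_small; auto; lra.
Qed.

Lemma holo_comp_pow (f : C * C -> C) (m n : nat) : (0 < m)%nat -> (0 < n)%nat ->
  holomorphic_germ f -> holomorphic_germ (fun z => f (fst z ^ m, snd z ^ n)%C).
Proof.
intros Hm Hn H; apply holomorphic_germ_iff in H; destruct H as (r & Hr & H).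
apply holomorphic_germ_iff; exists (Rmin 1 r); split; [apply Rmin_glb_lt; lra|].
pose proof (Rmin_l 1 r); pose proof (Rmin_r 1 r).
intros x y Hx Hy.
apply (cdiff2_comp f (fun z => fst z ^ m)%C (fun z => snd z ^ n)%C).
- apply H; apply Cmod_pow_small; auto; cbn [fst snd]; lra.
- apply cdiff2_pow, cdiff2_fst.
- apply cdiff2_pow, cdiff2_snd.
Qed.

Lemma holo_swap (f : C * C -> C) :
  holomorphic_germ f -> holomorphic_germ (fun z => f (snd z, fst z)).
Proof.
intros H; apply holomorphic_germ_iff in H; destruct H as (r & Hr & H).
apply holomorphic_germ_iff; exists r; split; auto; intros x y Hx Hy.
apply (cdiff2_comp f snd fst); auto using cdiff2_fst, cdiff2_snd.
Qed.

Lemma locally_swap (P : C * C -> Prop) :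
  locally origin P -> locally origin (fun z : C2 => P (snd z, fst z)).
Proof.
intros H; apply locally_origin in H; destruct H as (r & Hr & H).
apply locally_origin; exists r; split; auto.
Qed.

(** Inductive rather than an indexed double sum, so that averaging can be pushed through a
    decomposition by induction, in parallel with the constructors of [OX_span]. *)
Inductive monomial_sum (d : nat) : (C * C -> C) -> Prop :=
  | monomial_sum_term a b h : holomorphic_germ h ->
      monomial_sum d (fun z => mono a b z * h (fst z ^ d, snd z ^ d))%C
  | monomial_sum_zero : monomial_sum d (fun _ => RtoC 0)
  | monomial_sum_add f g : monomial_sum d f -> monomial_sum d g ->
      monomial_sum d (fun z => f z + g z)%C
  | monomial_sum_germ f g : germ_eq f g -> monomial_sum d f -> monomial_sum d g.

Lemma monomial_sum_csum (d n : nat) (f : nat -> C * C -> C) :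
  (forall i, monomial_sum d (f i)) -> monomial_sum d (fun z => csum n (fun i => f i z)).
Proof.
intros H; induction n as [|n IH]; cbn [csum].
- apply monomial_sum_zero.
- now apply monomial_sum_add.
Qed.

Theorem holo_monomial_sum (d : nat) (f : C * C -> C) : (0 < d)%nat ->
  holomorphic_germ f -> monomial_sum d f.
Proof.
intros Hd Hf; destruct (split_fst f d Hd Hf) as (h & Hh & E).
apply (monomial_sum_germ d _ _ (germ_eq_sym _ _ E)).
apply monomial_sum_csum; intros a.
destruct (split_fst _ d Hd (holo_swap _ (Hh a))) as (k & Hk & E').
apply monomial_sum_germ with
  (f := (fun z => csum d (fun b => mono a b z * k b (snd z ^ d, fst z ^ d)))%C).
- apply locally_swap in E'.
  (* The coefficient is evaluated at [(x^d, y)], so its expansion is pulled back along that map; [y]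
     appears as a first power. *)
  apply (locally_pow _ d 1 Hd Nat.lt_0_1) in E'.
  refine (locally_imp _ _ _ E'); intros [x y] Ez.
  assert (Ez' : h a (x ^ d, y)%C = csum d (fun b => y ^ b * k b (y ^ d, x ^ d))%C)
    by (rewrite <- (Cpow_1_r y); exact Ez).
  change (csum d (fun b => mono a b (x, y) * k b (y ^ d, x ^ d))
    = x ^ a * h a (x ^ d, y))%C.
  rewrite Ez', <- csum_scal.
  apply csum_ext; intros; unfold mono; cbn [fst snd]; ring.
- apply monomial_sum_csum; intros b.
  apply (monomial_sum_term d a b (fun z => k b (snd z, fst z))), holo_swap, Hk.
Qed.

(** * Integer powers *)

Lemma Cpowz_diff (z : C) (m n : nat) : z <> 0%C ->
  Cpowz z (Z.of_nat m - Z.of_nat n) = (z ^ m * / z ^ n)%C.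
Proof.
intros Hz; pose proof (fun n => Cpow_nz z n Hz) as Hp.
destruct (Nat.le_ge_cases n m) as [L|L].
- replace m with (n + (m - n))%nat at 2 by lia.
  rewrite Cpow_add_r; transitivity (z ^ (m - n))%C; [|field; auto].
  rewrite <- Nat2Z.inj_sub by lia; destruct (m - n)%nat as [|j]; [reflexivity|].
  cbn [Z.of_nat Cpowz]; now rewrite SuccNat2Pos.id_succ.
- replace n with (m + (n - m))%nat at 2 by lia.
  rewrite Cpow_add_r; transitivity (/ z ^ (n - m))%C; [|field; auto].
  replace (Z.of_nat m - Z.of_nat n)%Z with (- Z.of_nat (n - m))%Z by lia.
  destruct (n - m)%nat as [|j].
  + change (RtoC 1 = / 1)%C; field.
  + cbn [Z.of_nat Z.opp Cpowz]; now rewrite SuccNat2Pos.id_succ.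
Qed.

(** With exponents written as differences of naturals, the rules for [Cpowz] need no case
    distinction on signs. *)
Lemma Z_diff (k : Z) : exists m n, k = (Z.of_nat m - Z.of_nat n)%Z.
Proof. exists (Z.to_nat k), (Z.to_nat (- k)); lia. Qed.

Lemma Cpowz_add (z : C) (a b : Z) : z <> 0%C ->
  Cpowz z (a + b) = (Cpowz z a * Cpowz z b)%C.
Proof.
intros Hz; pose proof (fun n => Cpow_nz z n Hz) as Hp.
destruct (Z_diff a) as (m & n & ->), (Z_diff b) as (m' & n' & ->).
replace (Z.of_nat m - Z.of_nat n + (Z.of_nat m' - Z.of_nat n'))%Z
  with (Z.of_nat (m + m') - Z.of_nat (n + n'))%Z by lia.
rewrite !Cpowz_diff, !Cpow_add_r by auto; field; auto.
Qed.

Lemma Cpowz_nat (z : C) (n : nat) : z <> 0%C -> Cpowz z (Z.of_nat n) = (z ^ n)%C.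
Proof.
intros Hz; replace (Z.of_nat n) with (Z.of_nat n - Z.of_nat 0)%Z by lia.
rewrite Cpowz_diff by auto; change (z ^ 0)%C with (RtoC 1); field.
Qed.

Lemma Cpowz_nonzero (z : C) (k : Z) : z <> 0%C -> Cpowz z k <> 0%C.
Proof.
intros Hz; pose proof (fun n => Cpow_nz z n Hz) as Hp.
destruct (Z_diff k) as (m & n & ->); rewrite Cpowz_diff by auto.
apply Cmult_neq_0; auto; intros E.
apply (Cpow_nz z n Hz); rewrite <- (Cmult_1_r (z ^ n)), <- (Cinv_r (z ^ n)) at 1 by auto.
rewrite E; ring.
Qed.

Lemma Cpowz_mul_nat (z : C) (k : Z) (n : nat) : z <> 0%C ->
  (Cpowz z k ^ n)%C = Cpowz z (k * Z.of_nat n).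
Proof.
intros Hz; induction n as [|n IH].
- now rewrite Z.mul_0_r.
- rewrite Cpow_S, IH, <- Cpowz_add by auto; f_equal; lia.
Qed.

Lemma Cpowz_mul (z : C) (a b : Z) : z <> 0%C -> Cpowz (Cpowz z a) b = Cpowz z (a * b).
Proof.
intros Hz; pose proof (Cpowz_nonzero z a Hz) as Ha.
destruct (Z_diff b) as (m & n & ->); rewrite Cpowz_diff by auto.
rewrite !Cpowz_mul_nat by auto.
replace (a * Z.of_nat m)%Z with (a * (Z.of_nat m - Z.of_nat n) + a * Z.of_nat n)%Z by ring.
rewrite Cpowz_add by auto; field; now apply Cpowz_nonzero.
Qed.

Lemma Cpowz_one (k : Z) : Cpowz 1 k = RtoC 1.
Proof.
assert (H : RtoC 1 <> 0%C) by (intros E; apply (f_equal fst) in E; cbn in E; lra).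
destruct (Z_diff k) as (m & n & ->); rewrite Cpowz_diff, !Cpow_1_l by auto; field.
Qed.

Section Eigen.
Variables (d q : Z).
Hypothesis Hd : (0 < d)%Z.

Lemma root_nonzero (xi : C) : root_of_unity d xi -> xi <> 0%C.
Proof.
intros H E; unfold root_of_unity in H; rewrite E in H.
destruct d as [|p|p]; try lia; cbn in H.
destruct (Pos2Nat.is_succ p) as [n En]; rewrite En, Cpow_S, Cmult_0_l in H.
apply (f_equal fst) in H; cbn in H; lra.
Qed.

Lemma root_powz (xi : C) (a b : Z) : root_of_unity d xi -> (d | a - b)%Z ->
  Cpowz xi a = Cpowz xi b.
Proof.
intros H [c Hc]; pose proof (root_nonzero xi H) as Hx.
replace a with (d * c + b)%Z by lia.
rewrite Cpowz_add, <- Cpowz_mul by auto; rewrite H, Cpowz_one; ring.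
Qed.

Lemma OX_congr (a b : Z) (f : C * C -> C) : (d | a - b)%Z -> OX d q a f -> OX d q b f.
Proof.
intros D [H E]; split; auto; intros xi Hxi.
rewrite <- (root_powz xi a b) by auto; auto.
Qed.

Lemma OX_germ (k : Z) (f g : C * C -> C) : germ_eq f g -> OX d q k f -> OX d q k g.
Proof.
intros E [H F]; split; [now apply (holo_germ_eq f)|]; intros xi Hxi.
pose proof (locally_scale _ xi (Cpowz xi q) E) as E'.
refine (locally_imp _ _ _ (locally_and _ _ (locally_and _ _ E E') (F xi Hxi))).
intros z [[E1 E2] E3]; exact (eq_trans (eq_sym E2) (eq_trans E3 (f_equal _ E1))).
Qed.

Lemma OX_zero (k : Z) : OX d q k (fun _ => RtoC 0).
Proof.
split; [apply holo_everywhere; intros; apply cdiff2_const|].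
intros xi _; apply locally_all; intros z; ring.
Qed.

Lemma OX_add (k : Z) (f g : C * C -> C) :
  OX d q k f -> OX d q k g -> OX d q k (fun z => f z + g z)%C.
Proof.
intros [Hf Ef] [Hg Eg]; split; [now apply holo_plus|]; intros xi Hxi.
refine (locally_imp _ _ _ (locally_and _ _ (Ef xi Hxi) (Eg xi Hxi))).
intros z [E1 E2]; cbv beta in *; rewrite E1, E2; ring.
Qed.

Lemma OX_mult (a b : Z) (f g : C * C -> C) :
  OX d q a f -> OX d q b g -> OX d q (a + b) (fun z => f z * g z)%C.
Proof.
intros [Hf Ef] [Hg Eg]; split; [now apply holo_mult|]; intros xi Hxi.
refine (locally_imp _ _ _ (locally_and _ _ (Ef xi Hxi) (Eg xi Hxi))).
intros z [E1 E2]; cbv beta in *; rewrite E1, E2, Cpowz_add by now apply root_nonzero.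
ring.
Qed.

Lemma OX_one : OX d q 0 (fun _ => RtoC 1).
Proof.
split; [apply holo_everywhere; intros; apply cdiff2_const|].
intros xi _; apply locally_all; intros z; cbn; ring.
Qed.

Lemma OX_mono (a b : nat) : OX d q (Z.of_nat a + q * Z.of_nat b) (mono a b).
Proof.
split; [apply holo_mono|]; intros xi Hxi; apply locally_all; intros z.
pose proof (root_nonzero xi Hxi); unfold mono; cbn [fst snd].
rewrite !Cpow_mult_l, Cpowz_mul_nat, Cpowz_add, Cpowz_nat by auto; ring.
Qed.

Lemma OX_invariant (D : nat) (h : C * C -> C) : d = Z.of_nat D -> holomorphic_germ h ->
  OX d q 0 (fun z => h (fst z ^ D, snd z ^ D))%C.
Proof.
intros E Hh; assert (HD : (0 < D)%nat) by lia.
split; [now apply holo_comp_pow|]; intros xi Hxi; apply locally_all; intros z.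
pose proof (root_nonzero xi Hxi) as Hx; cbn [fst snd].
assert (E1 : (xi ^ D)%C = RtoC 1) by (rewrite <- Cpowz_nat, <- E by auto; exact Hxi).
rewrite !Cpow_mult_l, Cpowz_mul_nat, Z.mul_comm, <- Cpowz_mul, Cpowz_nat, E1, Cpowz_one by auto.
rewrite !Cmult_1_l; cbn; ring.
Qed.

Lemma products_of_OX (m : Z) (j : nat) (f : C * C -> C) :
  products_of (OX d q m) j f -> OX d q (m * Z.of_nat j) f.
Proof.
revert f; induction j as [|j IH]; cbn [products_of]; intros f H.
- rewrite Z.mul_0_r; apply (OX_germ _ _ _ (germ_eq_sym _ _ H)), OX_one.
- destruct H as (g & h & Hg & Hh & E).
  replace (m * Z.of_nat (S j))%Z with (m + m * Z.of_nat j)%Z by lia.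
  apply (OX_germ _ _ _ (germ_eq_sym _ _ E)), OX_mult; auto.
Qed.

Fixpoint weighted_sum (qs ks : nat -> Z) (n : nat) : Z :=
  match n with
  | O => 0
  | S m => weighted_sum qs ks m + qs (S m) * ks (S m)
  end%Z.

(** Weights add. Nonnegative exponents are asked for because [Z.to_nat] would truncate a negative
    one to zero while [weighted_sum] would count it. *)
Lemma mixed_products_OX (qs ks : nat -> Z) (n : nat) (f : C * C -> C) :
  (forall i, (1 <= i <= n)%nat -> (0 <= ks i)%Z) ->
  mixed_products d q qs ks n f -> OX d q (weighted_sum qs ks n) f.
Proof.
intros Hk; revert f; induction n as [|n IH]; cbn [mixed_products weighted_sum]; intros f H.
- apply (OX_germ _ _ _ (germ_eq_sym _ _ H)), OX_one.
- destruct H as (g & h & Hg & Hh & E).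
  apply (OX_germ _ _ _ (germ_eq_sym _ _ E)), OX_mult.
  + apply IH; auto; intros; apply Hk; lia.
  + apply products_of_OX in Hh; rewrite Z2Nat.id in Hh by (apply Hk; lia); exact Hh.
Qed.

Lemma OX_span_OX (S : (C * C -> C) -> Prop) (k : Z) (f : C * C -> C) :
  (forall g, S g -> OX d q k g) -> OX_span d q S f -> OX d q k f.
Proof.
intros HS; induction 1 as [f Hf| |f g _ IHf _ IHg|a f Ha _ IHf|f g E _ IHf]; auto.
- apply OX_zero.
- now apply OX_add.
- exact (OX_mult 0 k a f Ha IHf).
- now apply (OX_germ _ f).
Qed.

(** * Roots of unity and projection to a given weight *)

Definition zeta (j : Z) : C := circ (IZR j / IZR d).

Let d_pos : 0 < IZR d.
Proof. now apply IZR_lt. Qed.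

Lemma circ_add (s t : R) : circ (s + t) = (circ s * circ t)%C.
Proof.
unfold circ, Cmult; cbn [fst snd]; rewrite Rmult_plus_distr_l, cos_plus, sin_plus.
f_equal; ring.
Qed.

Lemma zeta_add (i j : Z) : zeta (i + j) = (zeta i * zeta j)%C.
Proof. unfold zeta; rewrite <- circ_add, plus_IZR; f_equal; field; lra. Qed.

Lemma zeta_0 : zeta 0 = RtoC 1.
Proof. unfold zeta; unfold Rdiv; rewrite Rmult_0_l; apply circ_0. Qed.

Lemma zeta_nonzero (j : Z) : zeta j <> 0%C.
Proof. apply Cmod_gt_0; unfold zeta; rewrite Cmod_circ; lra. Qed.

Lemma zeta_pow (j : Z) (n : nat) : (zeta j ^ n)%C = zeta (j * Z.of_nat n).
Proof.
induction n as [|n IH].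
- now rewrite Z.mul_0_r, zeta_0.
- rewrite Cpow_S, IH, <- zeta_add; f_equal; lia.
Qed.

Lemma zeta_powz (j k : Z) : Cpowz (zeta j) k = zeta (j * k).
Proof.
pose proof (zeta_nonzero j) as Hj.
destruct (Z_diff k) as (m & n & ->); rewrite Cpowz_diff, !zeta_pow by auto.
replace (j * Z.of_nat m)%Z with (j * (Z.of_nat m - Z.of_nat n) + j * Z.of_nat n)%Z by ring.
rewrite zeta_add; field; apply zeta_nonzero.
Qed.

Lemma zeta_d : zeta d = RtoC 1.
Proof. unfold zeta; rewrite Rdiv_diag by lra; apply circ_1. Qed.

Lemma zeta_multiple (j : Z) : (d | j)%Z -> zeta j = RtoC 1.
Proof.
intros [c ->]; rewrite Z.mul_comm, <- zeta_powz, zeta_d; apply Cpowz_one.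
Qed.

Lemma zeta_root (j : Z) : root_of_unity d (zeta j).
Proof. unfold root_of_unity; rewrite zeta_powz; apply zeta_multiple, Z.divide_factor_r. Qed.

(** Modulo [d] the angle becomes [2 pi t] with [0 < t < 1], and [cos (2 pi t) = 1 - 2 sin^2 (pi t)]
    is then less than 1. *)
Lemma zeta_neq_1 (j : Z) : ~ (d | j)%Z -> zeta j <> RtoC 1.
Proof.
intros D E.
assert (Hm : (0 <= j mod d < d)%Z) by (apply Z.mod_pos_bound; lia).
assert (N0 : (j mod d <> 0)%Z) by (intros Z0; apply D, Z.mod_divide; lia).
assert (E' : zeta (j mod d) = RtoC 1).
{ rewrite <- E; replace j with (d * (j / d) + j mod d)%Z at 2
    by (rewrite <- Z.div_mod; lia).
  rewrite zeta_add, (zeta_multiple (d * (j / d))); [ring | apply Z.divide_factor_l]. }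
assert (B1 : 0 < IZR (j mod d) / IZR d) by (apply Rdiv_lt_0_compat; auto; apply IZR_lt; lia).
assert (B2 : IZR (j mod d) / IZR d < 1).
{ apply Rlt_div_l; auto; rewrite Rmult_1_l; apply IZR_lt; lia. }
unfold zeta, circ in E'; set (t := IZR (j mod d) / IZR d) in *.
injection E' as Ec Es.
replace (2 * PI * t) with (2 * (PI * t)) in Ec by ring.
rewrite cos_2a_sin in Ec; pose proof PI_RGT_0.
assert (0 < sin (PI * t)) by (apply sin_gt_0; nra).
nra.
Qed.

(** Orthogonality of characters. For a nontrivial one, multiplication by [zeta m - 1] telescopes the
    sum to [zeta (d * m) - 1 = 0]. *)
Lemma zeta_sum (m : Z) (D : nat) : d = Z.of_nat D ->
  csum D (fun s => zeta (Z.of_nat s * m)) =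
    if Z.eqb (m mod d) 0 then RtoC (IZR d) else RtoC 0.
Proof.
intros ED; destruct (Z.eqb_spec (m mod d) 0) as [E|E].
- apply Z.mod_divide in E; [|lia].
  rewrite (csum_ext _ _ (fun _ => RtoC 1)) by
    (intros; apply zeta_multiple; now apply Z.divide_mul_r).
  rewrite csum_const, INR_IZR_INZ, <- ED; ring.
- assert (N : zeta m <> RtoC 1) by (apply zeta_neq_1; intros F; apply E, Z.mod_divide; auto; lia).
  assert (G : forall n, ((zeta m - 1) * csum n (fun s => zeta (Z.of_nat s * m))
     = zeta (Z.of_nat n * m) - 1)%C).
  { induction n as [|n IH]; cbn [csum].
    - rewrite Z.mul_0_l, zeta_0; ring.
    - rewrite Cmult_plus_distr_l, IH.
      replace (Z.of_nat (S n) * m)%Z with (Z.of_nat n * m + m)%Z by lia.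
      rewrite zeta_add; ring. }
  specialize (G D); rewrite <- ED, (zeta_multiple (d * m)) in G by apply Z.divide_factor_l.
  set (c := csum D _) in *.
  destruct (Ceq_dec c 0%C) as [|Nc]; [assumption|exfalso].
  apply (Cmult_neq_0 (zeta m - 1) c); auto; [now apply Cminus_eq_contra|].
  rewrite G; ring.
Qed.

(** The projector of the group of roots of unity onto the eigenspace of weight [k]. *)
Definition average (k : Z) (f : C * C -> C) (z : C * C) : C :=
  (/ IZR d * csum (Z.to_nat d) (fun s => zeta (Z.of_nat s * - k)
     * f (zeta (Z.of_nat s) * fst z, zeta (Z.of_nat s * q) * snd z)))%C.

Let dC : RtoC (IZR d) <> 0%C.
Proof. intros E; apply (f_equal fst) in E; cbn in E; lra. Qed.

Let d_nat : d = Z.of_nat (Z.to_nat d).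
Proof. lia. Qed.

(** An average involves [d] translates of a germ; this provides one neighbourhood on which all their
    identities hold. *)
Lemma locally_forall_lt (n : nat) (P : nat -> C * C -> Prop) :
  (forall i, locally origin (P i)) ->
  locally origin (fun z : C2 => forall i, (i < n)%nat -> P i z).
Proof.
intros H; induction n as [|n IH].
- apply locally_all; intros; lia.
- refine (locally_imp _ _ _ (locally_and _ _ IH (H n))).
  intros z [A B] i Hi; destruct (Nat.eq_dec i n) as [->|]; auto; apply A; lia.
Qed.

Lemma average_germ (k : Z) (f g : C * C -> C) :
  germ_eq f g -> germ_eq (average k f) (average k g).
Proof.
intros E.
refine (locally_imp _ _ _ (locally_forall_lt (Z.to_nat d) _
  (fun s => locally_scale _ (zeta (Z.of_nat s)) (zeta (Z.of_nat s * q)) E))).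
intros z Ez; unfold average; f_equal; apply csum_ext; intros s Hs; f_equal; auto.
Qed.

Lemma average_eigen (k : Z) (f : C * C -> C) : OX d q k f -> germ_eq (average k f) f.
Proof.
intros [_ E].
refine (locally_imp _ _ _ (locally_forall_lt (Z.to_nat d) _
  (fun s => E _ (zeta_root (Z.of_nat s))))).
intros z Ez; unfold average.
rewrite (csum_ext _ _ (fun _ => f z)).
- rewrite csum_const, INR_IZR_INZ, <- d_nat; field; auto.
- intros s Hs; specialize (Ez s Hs); rewrite !zeta_powz in Ez; rewrite Ez.
  rewrite Cmult_assoc, <- zeta_add.
  replace (Z.of_nat s * - k + Z.of_nat s * k)%Z with 0%Z by ring; rewrite zeta_0; ring.
Qed.

Lemma average_add (k : Z) (f g : C * C -> C) (z : C * C) :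
  average k (fun z => f z + g z)%C z = (average k f z + average k g z)%C.
Proof.
unfold average; rewrite <- Cmult_plus_distr_l; f_equal.
rewrite <- csum_plus; apply csum_ext; intros; ring.
Qed.

(** The factor in the [d]-th powers is invariant and the monomial has weight [a + q b], so each
    translate is a multiple of the term itself and [zeta_sum] decides whether it stays. *)
Lemma average_term (k : Z) (a b : nat) (h : C * C -> C) (z : C * C) :
  let D := Z.to_nat d in
  let f := fun z => (mono a b z * h (fst z ^ D, snd z ^ D))%C in
  average k f z =
    if Z.eqb ((Z.of_nat a + q * Z.of_nat b - k) mod d) 0 then f z else RtoC 0.
Proof.
intros D f; unfold average; fold D.
rewrite (csum_ext _ _ (fun s => f z *
  zeta (Z.of_nat s * (Z.of_nat a + q * Z.of_nat b - k)))%C).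
- rewrite csum_scal, zeta_sum by exact d_nat.
  destruct (Z.eqb _ _); [field; auto | ring].
- intros s Hs; unfold f, mono; cbn [fst snd].
  assert (E1 : (zeta (Z.of_nat s) ^ D)%C = RtoC 1)
    by (rewrite zeta_pow; unfold D; rewrite <- d_nat; apply zeta_multiple, Z.divide_factor_r).
  assert (E2 : (zeta (Z.of_nat s * q) ^ D)%C = RtoC 1)
    by (rewrite zeta_pow; unfold D; rewrite <- d_nat; apply zeta_multiple, Z.divide_factor_r).
  rewrite !Cpow_mult_l, E1, E2, !Cmult_1_l, !zeta_pow.
  replace (Z.of_nat s * (Z.of_nat a + q * Z.of_nat b - k))%Z with
    (Z.of_nat s * - k + (Z.of_nat s * Z.of_nat a + Z.of_nat s * q * Z.of_nat b))%Z by ring.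
  rewrite !zeta_add; ring.
Qed.

Theorem OX_in_span (S : (C * C -> C) -> Prop) (k : Z) (f : C * C -> C) :
  (forall a b : nat, (d | Z.of_nat a + q * Z.of_nat b - k)%Z -> OX_span d q S (mono a b)) ->
  OX d q k f -> OX_span d q S f.
Proof.
intros HS Hf.
(* The partial sums of a decomposition of [f] need not have weight [k]; the induction therefore
   speaks of their averages, and [f] is its own average. *)
assert (A : forall g, monomial_sum (Z.to_nat d) g -> OX_span d q S (average k g)).
{ induction 1 as [a b h Hh| |g1 g2 _ IH1 _ IH2|g1 g2 E _ IH].
  - set (g := fun z => (mono a b z * h (fst z ^ Z.to_nat d, snd z ^ Z.to_nat d))%C).
    assert (Eg := average_term k a b h); cbv zeta in Eg; fold g in Eg.
    destruct (Z.eqb_spec ((Z.of_nat a + q * Z.of_nat b - k) mod d) 0) as [E|E].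
    + apply span_germ with
        (f := fun z => (h (fst z ^ Z.to_nat d, snd z ^ Z.to_nat d) * mono a b z)%C).
      * apply locally_all; intros z; rewrite Eg; unfold g; ring.
      * apply span_scale; [now apply OX_invariant|].
        apply HS, Z.mod_divide; auto; lia.
    + apply span_germ with (f := fun _ => RtoC 0); [|apply span_zero].
      apply locally_all; intros z; now rewrite Eg.
  - apply span_germ with (f := fun _ => RtoC 0); [|apply span_zero].
    apply locally_all; intros z; unfold average.
    rewrite (csum_ext _ _ (fun _ => RtoC 0)), csum_const by (intros; ring); ring.
  - apply span_germ with (f := fun z => (average k g1 z + average k g2 z)%C).
    + apply locally_all; intros z; now rewrite average_add.
    + now apply span_add.
  - exact (span_germ _ _ _ _ _ (average_germ k g1 g2 E) IH). }
apply (span_germ _ _ _ _ _ (average_eigen k f Hf)), A.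
apply holo_monomial_sum; [lia | apply Hf].
Qed.
End Eigen.

(** * The greedy decomposition *)

Local Open Scope Z_scope.

(** The pair [(p_i, p_(i+1))]. *)
Fixpoint dual_pair (qs : nat -> Z) (i : nat) : Z * Z :=
  match i with
  | O => (0, 1)
  | S j => let (a, b) := dual_pair qs j in (b, ceil_div (qs j) (qs (S j)) * b - a)
  end.

(** Cramer's rule with determinant [d] gives integer coordinates [al], [be] of [(R, B)] in the basis
    [(q1, p1)], [(q2, p2)]. Since [q] decreases and [p] increases from the first vector to the
    second, every choice of signs puts [(R, B)] outside the box. *)
Lemma lattice_gap (d q q1 q2 p1 p2 R B : Z) :
  0 < d -> 0 < q2 < q1 -> 0 <= p1 < p2 -> q1 * p2 - q2 * p1 = d ->
  (d | q * p1 - q1) -> (d | q * p2 - q2) -> (d | q * B - R) ->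
  0 < R < q1 -> 0 <= B < p2 -> False.
Proof.
intros Hd Hq Hp Hdet [t1 E1] [t2 E2] [u E] HR HB.
(* The numerators in Cramer's rule are divisible by [d] by the three congruences. *)
assert (Ha : R * p2 - B * q2 = d * (B * t2 - u * p2)).
{ replace q2 with (q * p2 - t2 * d) by lia; replace R with (q * B - u * d) by lia; ring. }
assert (Hb : B * q1 - R * p1 = d * (u * p1 - B * t1)).
{ replace q1 with (q * p1 - t1 * d) by lia; replace R with (q * B - u * d) by lia; ring. }
set (al := B * t2 - u * p2) in *; set (be := u * p1 - B * t1) in *.
assert (ER : R = al * q1 + be * q2).
{ apply (Z.mul_reg_l _ _ d); [lia|].
  replace (d * (al * q1 + be * q2)) with (d * al * q1 + d * be * q2) by ring.
  rewrite <- Ha, <- Hb, <- Hdet; ring. }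
assert (EB : B = al * p1 + be * p2).
{ apply (Z.mul_reg_l _ _ d); [lia|].
  replace (d * (al * p1 + be * p2)) with (d * al * p1 + d * be * p2) by ring.
  rewrite <- Ha, <- Hb, <- Hdet; ring. }
clearbody al be; clear - Hq Hp HR HB ER EB.
(* For positive [al], [R < q1] makes [be] negative, [B >= 0] gives [be >= 1 - al], and then
   [R >= q1 + (al - 1) (q1 - q2)], a contradiction. *)
destruct (Z_lt_le_dec 0 al) as [Ha|Ha].
- assert (be < 0) by nia.
  assert (- be < al).
  { destruct (Z_lt_le_dec (- be) al) as [|L]; [assumption|exfalso].
    assert (be * p2 <= - al * p2) by (apply Z.mul_le_mono_nonneg_r; lia).
    assert (0 < al * (p2 - p1)) by (apply Z.mul_pos_pos; lia); lia. }
  assert ((1 - al) * q2 <= be * q2) by (apply Z.mul_le_mono_nonneg_r; lia).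
  assert (0 <= (al - 1) * (q1 - q2)) by (apply Z.mul_nonneg_nonneg; lia); lia.
- destruct (Z.eq_dec al 0) as [->|Ha0].
  { assert (0 < be) by nia.
    assert (1 * p2 <= be * p2) by (apply Z.mul_le_mono_nonneg_r; lia); lia. }
  (* For negative [al], [R > 0] gives [be >= 1 - al], and then [B >= p2 - al (p2 - p1)], a
     contradiction. *)
  assert (- al < be).
  { destruct (Z_lt_le_dec (- al) be) as [|L]; [assumption|exfalso].
    assert (be * q2 <= - al * q2) by (apply Z.mul_le_mono_nonneg_r; lia).
    assert (0 < - al * (q1 - q2)) by (apply Z.mul_pos_pos; lia); lia. }
  assert ((1 - al) * p2 <= be * p2) by (apply Z.mul_le_mono_nonneg_r; lia).
  assert (0 <= - al * (p2 - p1)) by (apply Z.mul_nonneg_nonneg; lia); lia.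
Qed.

(** * Splitting factors off a monomial in the greedy order *)

Section Decomposition.
Variables (d q : Z) (n : nat) (qs : nat -> Z).
Hypothesis Hq : 1 <= q < d.
Hypothesis Hqs : numerical_data d q n qs.

Let Hd : 0 < d.
Proof. lia. Qed.

Lemma numerical_data_pos (i : nat) : (i <= n)%nat -> 0 < qs i.
Proof.
destruct Hqs as [_ _ _ Hdec Hn _]; intros Hi.
assert (H : forall j, (j <= n)%nat -> 0 < qs (n - j)%nat).
{ induction j as [|j IH]; intros Hj.
  - rewrite Nat.sub_0_r; lia.
  - specialize (Hdec (n - S j)%nat ltac:(lia)); specialize (IH ltac:(lia)).
    replace (S (n - S j))%nat with (n - j)%nat in Hdec by lia; lia. }
replace i with (n - (n - i))%nat by lia; apply H; lia.
Qed.

Lemma numerical_data_nonneg (i : nat) : (i <= S n)%nat -> 0 <= qs i.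
Proof.
intros Hi; destruct (Nat.eq_dec i (S n)) as [->|].
- rewrite (nd_end _ _ _ _ Hqs); lia.
- pose proof (numerical_data_pos i ltac:(lia)); lia.
Qed.

(** Both coordinates follow the recurrence with coefficient [c_i], so the determinant and the
    congruences pass from one pair to the next; [c_i >= 2] makes the [p_i] increase. *)
Lemma dual_pair_spec (i : nat) : (i <= n)%nat ->
  let (a, b) := dual_pair qs i in
  0 <= a < b /\ qs i * b - qs (S i) * a = d /\
  (d | q * a - qs i) /\ (d | q * b - qs (S i)).
Proof.
induction i as [|i IH]; intros Hi; cbn [dual_pair].
- rewrite (nd_0 _ _ _ _ Hqs), (nd_1 _ _ _ _ Hqs); repeat split; try lia.
  + exists (-1); lia.
  + exists 0; lia.
- specialize (IH ltac:(lia)); destruct (dual_pair qs i) as [a b].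
  destruct IH as (Hab & Hdet & [u Hu] & [v Hv]).
  pose proof (nd_step _ _ _ _ Hqs i ltac:(lia)) as Hs.
  pose proof (nd_decr _ _ _ _ Hqs i ltac:(lia)) as Hdec.
  pose proof (numerical_data_pos (S i) ltac:(lia)) as H1.
  pose proof (numerical_data_nonneg (S (S i)) ltac:(lia)) as H2.
  set (c := ceil_div (qs i) (qs (S i))) in *.
  (* From [c * qs (S i) >= qs i > qs (S i)]. *)
  assert (Hc : 2 <= c) by nia.
  repeat split; [lia|nia| | |].
  + rewrite <- Hdet, Hs; ring.
  + now exists v.
  + exists (c * v - u).
    replace (qs (S (S i))) with (c * qs (S i) - qs i) by lia.
    replace (q * (c * b - a) - (c * qs (S i) - qs i)) with
      (c * (q * b - qs (S i)) - (q * a - qs i)) by ring.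
    rewrite Hu, Hv; ring.
Qed.

(** If both inequalities failed, [(r - a, b)] would be a lattice point in the box excluded by
    [lattice_gap]: [a < qs (S j) <= r] makes its first coordinate positive. *)
Lemma first_digit_divides (j : nat) (a b : nat) (r : Z) : (j < n)%nat ->
  qs (S j) <= r < qs j -> (d | Z.of_nat a + q * Z.of_nat b - r) ->
  qs (S j) <= Z.of_nat a \/ snd (dual_pair qs j) <= Z.of_nat b.
Proof.
intros Hj Hr [u Hu].
destruct (Z_le_gt_dec (qs (S j)) (Z.of_nat a)) as [|Ha]; [now left|right].
destruct (Z_le_gt_dec (snd (dual_pair qs j)) (Z.of_nat b)) as [|Hb]; [assumption|exfalso].
pose proof (dual_pair_spec j ltac:(lia)) as D.
destruct (dual_pair qs j) as [p1 p2]; cbn [snd] in Hb.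
destruct D as (Hp & Hdet & D1 & D2).
pose proof (numerical_data_pos (S j) ltac:(lia)).
apply (lattice_gap d q (qs j) (qs (S j)) p1 p2 (r - Z.of_nat a) (Z.of_nat b)); auto; try lia.
exists u; lia.
Qed.

Lemma mono_mult (a b a' b' : nat) (z : C * C) :
  mono (a + a') (b + b') z = Cmult (mono a b z) (mono a' b' z).
Proof. unfold mono; rewrite !Cpow_add_r; ring. Qed.

Lemma extract_factor (j a b : nat) (r : Z) : (j < n)%nat ->
  qs (S j) <= r < qs j -> (d | Z.of_nat a + q * Z.of_nat b - r) ->
  exists A B a' b', a = (A + a')%nat /\ b = (B + b')%nat /\
    OX d q (qs (S j)) (mono A B) /\
    (d | Z.of_nat a' + q * Z.of_nat b' - (r - qs (S j))).
Proof.
intros Hj Hr [u Hu].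
pose proof (numerical_data_pos (S j) ltac:(lia)).
destruct (first_digit_divides j a b r Hj Hr (ex_intro _ u Hu)) as [Ha|Hb].
- set (A := Z.to_nat (qs (S j))); assert (EA : Z.of_nat A = qs (S j)) by (unfold A; lia).
  exists A, 0%nat, (a - A)%nat, b; split; [lia|split; [lia|split]].
  + refine (OX_congr d q Hd _ _ _ _ (OX_mono d q Hd A 0)); exists 0; lia.
  + exists u; rewrite Nat2Z.inj_sub by lia; lia.
- pose proof (dual_pair_spec j ltac:(lia)) as D.
  destruct (dual_pair qs j) as [p1 p2]; cbn [snd] in Hb.
  destruct D as (Hp & _ & _ & [v Hv]).
  set (B := Z.to_nat p2); assert (EB : Z.of_nat B = p2) by (unfold B; lia).
  exists 0%nat, B, a, (b - B)%nat; split; [lia|split; [lia|split]].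
  + refine (OX_congr d q Hd _ _ _ _ (OX_mono d q Hd 0 B)); exists v; rewrite EB; lia.
  + exists (u - v); rewrite Nat2Z.inj_sub, EB by lia; lia.
Qed.

(** As long as a factor remains to be taken, the residue is at least [qs (S j)]; as it only
    decreases, it also stays below [qs j], so [extract_factor] applies each time. *)
Lemma extract_factors (j m a b : nat) (r : Z) : (j < n)%nat ->
  r < qs j -> Z.of_nat m * qs (S j) <= r -> (d | Z.of_nat a + q * Z.of_nat b - r) ->
  exists A B a' b', a = (A + a')%nat /\ b = (B + b')%nat /\
    products_of (OX d q (qs (S j))) m (mono A B) /\
    (d | Z.of_nat a' + q * Z.of_nat b' - (r - Z.of_nat m * qs (S j))).
Proof.
intros Hj; pose proof (numerical_data_pos (S j) ltac:(lia)).
revert a b r; induction m as [|m IH]; intros a b r Hr Hm D.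
- exists 0%nat, 0%nat, a, b; split; [lia|split; [lia|split]].
  + apply locally_all; intros z; unfold mono; cbn [Cpow]; ring.
  + now replace (r - Z.of_nat 0 * qs (S j)) with r by lia.
- destruct (extract_factor j a b r Hj ltac:(nia) D) as (A & B & a' & b' & Ea & Eb & HM & D').
  destruct (IH a' b' (r - qs (S j)) ltac:(lia) ltac:(lia) D')
    as (A' & B' & a'' & b'' & Ea' & Eb' & HM' & D'').
  exists (A + A')%nat, (B + B')%nat, a'', b''; split; [lia|split; [lia|split]].
  + exists (mono A B), (mono A' B'); split; [assumption|split; [assumption|]].
    apply locally_all; intros z; apply mono_mult.
  + now replace (r - Z.of_nat (S m) * qs (S j)) with
      (r - qs (S j) - Z.of_nat m * qs (S j)) by lia.
Qed.

Lemma greedy_rem_bounds (k : Z) (i : nat) : (i <= n)%nat -> 0 <= greedy_rem d qs k i < qs i.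
Proof.
destruct i as [|i]; intros Hi; cbn [greedy_rem].
- rewrite (nd_0 _ _ _ _ Hqs); apply Z.mod_pos_bound, Hd.
- apply Z.mod_pos_bound, numerical_data_pos, Hi.
Qed.

Lemma greedy_digit (k : Z) (j : nat) : (j < n)%nat ->
  greedy d n qs k (S j) = greedy_rem d qs k j / qs (S j).
Proof. intros Hj; unfold greedy; now rewrite (proj2 (Nat.leb_le (S j) n)) by lia. Qed.

Lemma greedy_step (k : Z) (j : nat) : (j < n)%nat ->
  greedy_rem d qs k j = qs (S j) * greedy d n qs k (S j) + greedy_rem d qs k (S j).
Proof.
intros Hj; rewrite greedy_digit by assumption; apply Z.div_mod.
pose proof (numerical_data_pos (S j) ltac:(lia)); lia.
Qed.

Lemma greedy_nonneg (k : Z) (i : nat) : 0 <= greedy d n qs k i.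
Proof.
destruct i as [|j]; cbn [greedy]; [lia|].
destruct (Nat.leb_spec (S j) n) as [L|L]; [|lia].
apply Z.div_pos; [apply greedy_rem_bounds; lia | apply numerical_data_pos, L].
Qed.

Lemma greedy_sum (k : Z) (i : nat) : (i <= n)%nat ->
  weighted_sum qs (greedy d n qs k) i + greedy_rem d qs k i = k mod d.
Proof.
induction i as [|i IH]; intros Hi; [reflexivity|].
cbn [weighted_sum]; rewrite <- IH, (greedy_step k i) by lia; ring.
Qed.

Lemma greedy_rem_last (k : Z) : greedy_rem d qs k n = 0.
Proof.
pose proof (greedy_rem_bounds k n (le_n n)) as H; rewrite (nd_n _ _ _ _ Hqs) in H; lia.
Qed.

(** The invariant of the greedy procedure: the part not yet factored has the current Euclidean
    remainder as its weight, which is exactly the range required for the next digit. *)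
Lemma mono_factorization (k : Z) (a b i : nat) : (i <= n)%nat ->
  (d | Z.of_nat a + q * Z.of_nat b - k) ->
  exists A B a' b', a = (A + a')%nat /\ b = (B + b')%nat /\
    mixed_products d q qs (greedy d n qs k) i (mono A B) /\
    (d | Z.of_nat a' + q * Z.of_nat b' - greedy_rem d qs k i).
Proof.
intros Hi D; induction i as [|j IH].
- exists 0%nat, 0%nat, a, b; split; [lia|split; [lia|split]].
  + apply locally_all; intros z; unfold mono; cbn [Cpow]; ring.
  (* The procedure starts from [k mod d], which differs from [k] by [d * (k / d)]. *)
  + cbn [greedy_rem]; destruct D as [u Hu]; exists (u + k / d).
    pose proof (Z.div_mod k d ltac:(lia)); lia.
- destruct (IH ltac:(lia)) as (A & B & a' & b' & Ea & Eb & HM & D').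
  pose proof (greedy_step k j Hi) as Hs; pose proof (greedy_nonneg k (S j)) as H0.
  pose proof (greedy_rem_bounds k j ltac:(lia)); pose proof (greedy_rem_bounds k (S j) Hi).
  set (m := Z.to_nat (greedy d n qs k (S j))).
  assert (Em : Z.of_nat m = greedy d n qs k (S j)) by (unfold m; lia).
  destruct (extract_factors j m a' b' (greedy_rem d qs k j) Hi ltac:(lia)
    ltac:(rewrite Em; lia) D') as (A' & B' & a'' & b'' & Ea' & Eb' & HM' & D'').
  exists (A + A')%nat, (B + B')%nat, a'', b''; split; [lia|split; [lia|split]].
  + exists (mono A B), (mono A' B'); split; [assumption|split; [assumption|]].
    apply locally_all; intros z; apply mono_mult.
  + replace (greedy_rem d qs k (S j)) with
      (greedy_rem d qs k j - Z.of_nat m * qs (S j)) by (rewrite Em, Hs; ring).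
    exact D''.
Qed.

Lemma mono_in_product (k : Z) (a b : nat) : (d | Z.of_nat a + q * Z.of_nat b - k) ->
  eigenmodule_product d q qs (greedy d n qs k) n (mono a b).
Proof.
intros D; destruct (mono_factorization k a b n (le_n n) D)
  as (A & B & a' & b' & -> & -> & HM & D').
rewrite greedy_rem_last in D'.
apply span_germ with (f := fun z => Cmult (mono a' b' z) (mono A B z)).
- apply locally_all; intros z; rewrite mono_mult; ring.
(* Since [qs n = 1] the last remainder is 0, so the leftover monomial is invariant and serves as the
   coefficient in [O_X]. *)
- apply span_scale; [|now apply span_gen].
  exact (OX_congr d q Hd _ _ _ D' (OX_mono d q Hd a' b')).
Qed.
End Decomposition.

Theorem theorem0p3 (d q : Z) (Hq : 1 <= q < d) (Hgcd : Z.gcd d q = 1)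
    (n : nat) (qs : nat -> Z) (Hqs : numerical_data d q n qs) (k : Z)
    (f : C * C -> C) :
  OX d q k f <-> eigenmodule_product d q qs (greedy d n qs k) n f.
Proof.
assert (Hd : 0 < d) by lia; split.
- apply OX_in_span; [assumption|].
  intros a b D; now apply mono_in_product.
- apply OX_span_OX; [assumption|]; intros g Hg.
  apply mixed_products_OX in Hg; [|assumption|intros; eapply greedy_nonneg; eassumption].
  refine (OX_congr d q Hd _ _ _ _ Hg).
  pose proof (greedy_sum d q n qs Hqs k n (le_n n)) as E.
  rewrite (greedy_rem_last d q n qs Hq Hqs) in E.
  exists (- (k / d)); pose proof (Z.div_mod k d ltac:(lia)); lia.
Qed.
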